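(* Let $0<\lambda<1$, $\beta>0$, $\sigma\ge 0$ and $\alpha\ge 0$. For each $(N,d)$ let $X\in\mathbb{R}^{N\times d}$ have independent entries with distribution $N(0,1/N)$, let $\beta_0\in\mathbb{R}^d$ be deterministic, and let $Y=X\beta_0+\sigma\epsilon$, where $\epsilon\in\mathbb{R}^N$ has i.i.d. $N(0,1)$ entries independent of $X$. Consider the limit $N,d\to\infty$ with $d/N\to\lambda$ and $|\beta_0|^2/d\to\beta^2$. Let $\hat\beta=\frac{1}{1+\alpha}(X^TX)^{-1}X^TY$ be the spectral estimator with regularization strength $\alpha$, and let $MSE=\mathbb{E}_{x\sim N(0,I_d/N)}(\langle x,\beta_0\rangle-\langle x,\hat\beta\rangle)^2$. Then in this limit the average test error $\mathbb{E}_{X,Y}MSE$ converges to $$Err_\infty(\alpha)=\frac{\lambda\beta^2\alpha^2+\frac{\lambda}{1-\lambda}\sigma^2}{(1+\alpha)^2}.$$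
   Context: Inside $MSE$ the expectation is over the test point $x$, independent of $(X,Y)$, with $(X,Y)$ held fixed. In the limit considered $d<N$ eventually, so $X^TX$ is almost surely invertible. *)

(* Defs.v *)
From HB Require Import structures.
From mathcomp Require Export all_boot all_order all_algebra.
From mathcomp Require Export all_classical all_reals all_analysis.
Export Order.TTheory GRing.Theory Num.Theory numFieldNormedType.Exports.

Set Implicit Arguments.
Unset Strict Implicit.
Unset Printing Implicit Defensive.

Local Open Scope classical_set_scope.
Local Open Scope ring_scope.

Definition mutually_independent (R : realType) (disp : measure_display)
    (T : measurableType disp) (P : probability T R) (I : finType)
    (X : I -> {RV P >-> R}) : Prop :=
  forall (J : {set I}) (A : I -> set R), (forall i, measurable (A i)) ->
    P (\bigcap_(i in [set` J]) (X i @^-1` A i)) =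
    (\prod_(i in J) P (X i @^-1` A i))%E.

Definition sigma_generated (R : realType) (disp : measure_display)
    (T : measurableType disp) (P : probability T R) (I : finType)
    (X : I -> {RV P >-> R}) : set (set T) :=
  <<s [set B | exists (i : I) (A : set R), measurable A /\ B = X i @^-1` A] >>.

Definition independent_families (R : realType) (disp : measure_display)
    (T : measurableType disp) (P : probability T R) (I J : finType)
    (X : I -> {RV P >-> R}) (Z : J -> {RV P >-> R}) : Prop :=
  forall A B : set T, sigma_generated X A -> sigma_generated Z B ->
    P (A `&` B) = (P A * P B)%E.

(* [normal_prob] takes the standard deviation, hence the square root; laws are
   compared on measurable sets only, as both sides are junk elsewhere. *)
Definition iid_centered_normal (R : realType) (disp : measure_display)
    (T : measurableType disp) (P : probability T R) (I : finType)
    (X : I -> {RV P >-> R}) (variance : R) : Prop :=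
  mutually_independent X /\
  forall (i : I) (A : set R), measurable A ->
    distribution P (X i) A = normal_prob 0 (Num.sqrt variance) A.

Definition random_matrix (R : realType) (disp : measure_display)
    (T : measurableType disp) (P : probability T R) (N d : nat)
    (X : 'I_N * 'I_d -> {RV P >-> R}) (w : T) : 'M[R]_(N, d) :=
  \matrix_(i, j) X (i, j) w.

Definition random_vector (R : realType) (disp : measure_display)
    (T : measurableType disp) (P : probability T R) (n : nat)
    (x : 'I_n -> {RV P >-> R}) (w : T) : 'cV[R]_n :=
  \col_i x i w.

Definition dot (R : realType) (n : nat) (u v : 'cV[R]_n) : R :=
  \sum_i u i 0 * v i 0.

(* [invmx A] is [A] itself when [A] is singular. *)
Definition spectral_estimator (R : realType) (N d : nat) (alpha : R)
    (X : 'M[R]_(N, d)) (Y : 'cV[R]_N) : 'cV[R]_d :=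
  (1 + alpha)^-1 *: (invmx (X^T *m X) *m X^T *m Y).

(* The test point [x] lives on its own probability space, so that the training
   data, on which [betahat] depends, are held fixed in the expectation. *)
Definition MSE (R : realType) (disp : measure_display)
    (S : measurableType disp) (Q : probability S R) (d : nat)
    (x : 'I_d -> {RV Q >-> R}) (beta0 betahat : 'cV[R]_d) : \bar R :=
  'E_Q[fun s => (dot (random_vector x s) beta0
                 - dot (random_vector x s) betahat) ^+ 2].

Definition average_test_error (R : realType) (dispT dispS : measure_display)
    (T : measurableType dispT) (P : probability T R)
    (S : measurableType dispS) (Q : probability S R) (N d : nat)
    (sigma alpha : R) (beta0 : 'cV[R]_d)
    (X : 'I_N * 'I_d -> {RV P >-> R}) (eps : 'I_N -> {RV P >-> R})
    (x : 'I_d -> {RV Q >-> R}) : \bar R :=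
  let Y w := random_matrix X w *m beta0 + sigma *: random_vector eps w in
  \int[P]_w MSE x beta0 (spectral_estimator alpha (random_matrix X w) (Y w)).

Definition Err_infty (R : realType) (lambda beta sigma alpha : R) : R :=
  (lambda * beta ^+ 2 * alpha ^+ 2 + lambda / (1 - lambda) * sigma ^+ 2)
  / (1 + alpha) ^+ 2.

(* Main.v *)
(* Write G = X^T X.  Almost surely betahat - beta0 equals
   (-alpha beta0 + sigma G^-1 X^T eps) / (1 + alpha), so averaging first over x,
   then over eps, reduces the error to E tr(G^-1), for which we show
   E tr(G^-1) = N d / (N - d - 1).

   Put B = (G + t)^-1 with t > 0.  As a function of the single entry X_ij, the
   entry (X B)_ij is (a x + b) / (1 + a x^2 + 2 b x + c), where a, b and c only
   involve the other entries of X (Sherman-Morrison for row i).  Gaussian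
   integration by parts in X_ij, summed over i and j, gives the exact identity
     E [t tr B + ((N-d-1) tr B + t (tr B)^2 + t tr(B^2)) / N] = d.
   Letting t go to 0, Fatou's lemma bounds E lim tr B; since tr B is at least of
   order 1/t when G is singular, G is almost surely invertible.  Dominated
   convergence then yields (N-d-1) E tr(G^-1) = N d. *)
From HB Require Import structures.
Require Import Defs.
From mathcomp Require Import measurable_realfun ring lra.

Set Implicit Arguments.
Unset Strict Implicit.
Unset Printing Implicit Defensive.

Local Open Scope classical_set_scope.
Local Open Scope ring_scope.

(** * Stein identities for the centered normal law *)

(** Nothing is known about G^-1 beforehand, neither that G is almost surely invertible nor that
    tr(G^-1) is integrable, so integration by parts cannot be applied to it directly. The shift t
    bounds the entries of B by d/t, and every one-entry Stein integrand is then dominated by a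
    constant times 1 + x^2. Working with one entry at a time needs only the normal density on the
    line and independence: no Wishart density and no rotation invariance. Adding a multiple of 1 +
    x^2, whose mean is explicit, makes each integrand nonnegative, so that Tonelli's theorem applies
    without a separate integrability proof. In N-d-1, the N comes from differentiating X in XB, the
    other two terms from differentiating B: they are tr(B) tr(GB) and tr(GB^2), and GB = 1 - tB. *)

Section normal_analysis.
Variable R : realType.
Local Notation mu := (@lebesgue_measure R).

(** The bound on [|x| * |F x|] makes the boundary values of [F] on [-n-1, n+1] of order 1/n, and
    dominated convergence passes from these intervals to the whole line. *)
Lemma integral_derive_eq0 (F f : R -> R) (K : R) :
  (forall x : R, is_derive x 1 F (f x)) -> continuous f ->
  mu.-integrable setT (EFin \o f) -> (forall x, `|x| * `|F x| <= K) ->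
  (\int[mu]_x (f x)%:E = 0)%E.
Proof.
move=> dF cf intf FK.
pose D n : set R := `[- n.+1%:R, n.+1%:R]%classic.
have mD n : measurable (D n) by exact: measurable_itv.
have cF : continuous F.
  move=> x; apply/differentiable_continuous/derivable1_diffP.
  by have [] := dF x.
have intD n : (\int[mu]_x ((f \_ (D n)) x)%:E =
    (F n.+1%:R - F (- n.+1%:R))%:E)%E.
  have -> : (fun x => ((f \_ (D n)) x)%:E) = (EFin \o f) \_ (D n).
    by rewrite restrict_EFin.
  rewrite -integral_mkcond /D (@continuous_FTC2 _ f F)//.
  - by rewrite (@lt_trans _ _ 0)// ?oppr_lt0.
  - exact/continuous_subspaceT.
  - split; first by move=> x _; have [] := dF x.
    + exact/cvg_at_right_filter/cF.
    + exact/cvg_at_left_filter/cF.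
  - by move=> x _; rewrite derive1E; apply: derive_val.
have K0 : 0 <= K by apply: le_trans (FK 0); rewrite normr0 mul0r.
have F0 (u : nat -> R) : (forall n, `|u n| = n.+1%:R) ->
    F (u n) @[n --> \oo] --> 0.
  move=> hu; apply/norm_cvg0P.
  apply: (@squeeze_cvgr _ _ _ _ (cst 0) (fun n => K * n.+1%:R^-1)).
  - apply: nearW => n; rewrite normr_ge0/= ler_pdivlMr// mulrC -hu.
    exact: FK.
  - exact: cvg_cst.
  - rewrite -[X in _ --> X](mulr0 K); apply: cvgMr; exact: cvg_harmonic.
have lim0 : (\int[mu]_x ((f \_ (D n)) x)%:E)%E @[n --> \oo] --> 0%E.
  under eq_fun do rewrite intD.
  apply: cvg_EFin; first by apply: nearW.
  rewrite -[X in _ --> X](subr0 (0:R)); apply: cvgB.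
    by apply: F0 => n; rewrite normr_nat.
  by apply: F0 => n; rewrite normrN normr_nat.
suff : (\int[mu]_x ((f \_ (D n)) x)%:E)%E @[n --> \oo] -->
    (\int[mu]_x (f x)%:E)%E by move=> h; apply: cvg_unique h lim0.
apply: (@dominated_cvg _ _ _ mu setT measurableT
  (fun n x => ((f \_ (D n)) x)%:E) (EFin \o f) (fun x => `|f x|%:E)) => //.
- move=> n; apply/measurable_EFinP.
  apply/(measurable_restrictT _ (mD n)).
  by apply: measurable_funTS; exact: continuous_measurable_fun.
- move=> x _; apply: cvg_EFin; first exact: nearW.
  apply: cvg_near_cst.
  near=> n.
  rewrite /= patchE ifT// inE /D /= in_itv/= -ler_norml.
  near: n; exists (Num.bound `|x|) => //= n hn.
  rewrite (le_trans (ltW (archi_boundP (normr_ge0 x))))// ler_nat.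
  exact: leqW.
- by have := integrable_abse intf.
- move=> n x _ /=; rewrite lee_fin patchE; case: ifPn => // _.
  by rewrite normr0.
Unshelve. all: by end_near. Qed.

End normal_analysis.

Section normal_moments.
Variables (R : realType) (s : R).
Hypothesis s_gt0 : 0 < s.
Local Notation mu := (@lebesgue_measure R).
Local Notation pdf := (normal_pdf 0 s).

Let s_neq0 : s != 0. Proof. exact: lt0r_neq0. Qed.

Lemma is_derive_normal_pdf (x : R) :
  is_derive x 1 pdf (- x / s ^+ 2 * pdf x).
Proof.
rewrite normal_pdfE// /normal_fun.
have -> : (fun y : R => normal_peak s * expR (- (y - 0) ^+ 2 / (s ^+ 2 *+ 2))) =
   (fun y : R => normal_peak s * expR ((- (s ^+ 2 *+ 2)^-1) * (y * y))).
  by apply/funext => y; congr (_ * expR _); rewrite subr0 expr2; ring.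
apply: is_derive_eq.
rewrite /GRing.scale /= subr0 -!expr2.
have -> : - x ^+ 2 / (s ^+ 2 *+ 2) = - (s ^+ 2 *+ 2)^-1 * x ^+ 2 by ring.
by field; rewrite ?s_neq0.
Qed.

(* Doubling the standard deviation absorbs the polynomial factor. *)
Lemma sqr_normal_pdf_le :
  exists2 C : R, 0 <= C & forall x, (1 + x ^+ 2) * pdf x <= C * normal_pdf 0 (2 * s) x.
Proof.
have s2_neq0 : 2 * s != 0 by rewrite mulf_neq0.
pose p := normal_peak s; pose p2 := normal_peak (2 * s).
have p0 : 0 < p by exact: normal_peak_gt0.
have p20 : 0 < p2 by exact: normal_peak_gt0.
(* With y = x^2/(8 s^2), the exponent -4y splits into -3y and -y, the latter belonging to the wider
   density. It remains to use 1 + x^2 <= (1 + 8 s^2)(1 + y) and 1 + y <= exp(3y); [p / p2] adjusts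
   the normalization. *)
exists ((1 + 8 * s ^+ 2) * p / p2).
  rewrite divr_ge0 ?mulr_ge0 ?(ltW p0) ?(ltW p20)//.
  by rewrite addr_ge0// mulr_ge0// sqr_ge0.
move=> x; rewrite !normal_pdfE// /normal_fun -/p -/p2 subr0.
have -> : - x ^+ 2 / (s ^+ 2 *+ 2) =
    - (3 * x ^+ 2 / (8 * s ^+ 2)) + - x ^+ 2 / ((2 * s) ^+ 2 *+ 2).
  by field.
rewrite expRD.
set e := expR (- x ^+ 2 / _).
rewrite (_ : _ / p2 * (p2 * e) = (1 + 8 * s ^+ 2) * (p * e)); last first.
  by field; exact: lt0r_neq0.
rewrite (_ : (1 + x ^+ 2) * _ =
  ((1 + x ^+ 2) * expR (- (3 * x ^+ 2 / (8 * s ^+ 2)))) * (p * e)); last by ring.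
rewrite ler_wpM2r ?mulr_ge0 ?expR_ge0 ?(ltW p0)//.
rewrite expRN ler_pdivrMr ?expR_gt0//.
have h : 1 + x ^+ 2 / (8 * s ^+ 2) <= expR (3 * x ^+ 2 / (8 * s ^+ 2)).
  apply: le_trans (expR_ge1Dx _); rewrite lerD2l ler_wpM2r//.
    by rewrite invr_ge0 mulr_ge0// sqr_ge0.
  by rewrite ler_peMl ?sqr_ge0// ler1n.
have s2 : 0 < s ^+ 2 by rewrite exprn_gt0.
have hx := sqr_ge0 x.
apply: (@le_trans _ _ ((1 + 8 * s ^+ 2) * (1 + x ^+ 2 / (8 * s ^+ 2)))); last first.
  by rewrite ler_wpM2l// addr_ge0// mulr_ge0// ltW.
rewrite mulrDl !mul1r mulrDr mulr1 (mulrC (_ * _) (_ / _)) divfK ?mulf_neq0//.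
  have : 0 <= x ^+ 2 / (8 * s ^+ 2) by rewrite divr_ge0// mulr_ge0// ltW.
  by nra.
Qed.

Lemma integrable_sqr_normal_pdf :
  mu.-integrable setT (fun x => ((1 + x ^+ 2) * pdf x)%:E).
Proof.
have [C C0 CP] := sqr_normal_pdf_le.
apply: (@le_integrable _ _ _ mu setT measurableT _
  (fun x => (C * normal_pdf 0 (2 * s) x)%:E)).
- apply/measurable_EFinP/measurable_funM; last exact: measurable_normal_pdf.
  by apply: measurable_funD.
- move=> x _ /=; rewrite lee_fin.
  rewrite !ger0_norm ?mulr_ge0 ?normal_pdf_ge0//.
  by rewrite addr_ge0// sqr_ge0.
- under eq_fun do rewrite EFinM.
  by apply: integrableZl => //; exact: integrable_normal_pdf.
Qed.

Lemma sqr_normal_pdf_bounded : exists K : R, forall x, (1 + x ^+ 2) * pdf x <= K.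
Proof.
have [C C0 CP] := sqr_normal_pdf_le.
exists (C * normal_peak (2 * s)) => x; apply: le_trans (CP x) _.
by rewrite ler_wpM2l// normal_pdf_ub// mulf_neq0.
Qed.

(** The change of variables yields an abstract Radon-Nikodym derivative. It has the same integral as
    the density over every measurable set, hence agrees with it almost everywhere. *)
Lemma integral_normal_prob (f : R -> R) : measurable_fun setT f ->
  (forall x, 0 <= f x) ->
  (\int[normal_prob 0 s]_x (f x)%:E = \int[mu]_x (f x * pdf x)%:E)%E.
Proof.
move=> mf f0.
have nudom := normal_prob_dominates (0 : R) s.
rewrite -(Radon_Nikodym_SigmaFinite.change_of_variables nudom)//; last exact/measurable_EFinP.
have h := Radon_Nikodym_SigmaFinite.f_integrable nudom.
under [RHS]eq_integral do rewrite EFinM.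
apply: ae_eq_integral => //.
- apply: emeasurable_funM; first exact/measurable_EFinP.
  exact: measurable_int h.
- apply: emeasurable_funM; first exact/measurable_EFinP.
  by apply/measurable_EFinP; exact: measurable_normal_pdf.
- apply: ae_eqe_mul2l; apply: integral_ae_eq => //.
  + by apply/measurable_EFinP; exact: measurable_normal_pdf.
  + by move=> E _ mE; rewrite -Radon_Nikodym_SigmaFinite.f_integral.
Qed.

End normal_moments.

Section normal_stein.
Variables (R : realType) (s : R).
Hypothesis s_gt0 : 0 < s.
Local Notation mu := (@lebesgue_measure R).
Local Notation pdf := (normal_pdf 0 s).

Let s_neq0 : s != 0. Proof. exact: lt0r_neq0. Qed.

(* The constant [v] is there to make the integrand nonnegative, so that only
   Tonelli's theorem is needed when this is applied conditionally. *)
Lemma normal_stein (h h' : R -> R) (K v : R) :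
  (forall x : R, is_derive x 1 h (h' x)) -> continuous h' ->
  (forall x, `|x| * `|h x| <= K * (1 + x ^+ 2)) ->
  (forall x, `|h' x| <= K * (1 + x ^+ 2)) ->
  (forall x, 0 <= x * h x - s ^+ 2 * h' x + v) ->
  (\int[normal_prob 0 s]_x (x * h x - s ^+ 2 * h' x + v)%:E = v%:E)%E.
Proof.
move=> dh ch' hK h'K g0.
have ch : continuous h.
  move=> x; apply/differentiable_continuous/derivable1_diffP.
  by have [] := dh x.
pose g x := x * h x - s ^+ 2 * h' x.
have cg : continuous g.
  move=> x; apply: cvgB; first by apply: cvgM; [exact: cvg_id|exact: ch].
  by apply: cvgM; [exact: cvg_cst|exact: ch'].
have mg : measurable_fun setT g by exact: continuous_measurable_fun.
have mpdf : measurable_fun setT pdf by exact: measurable_normal_pdf.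
have igp : mu.-integrable setT (fun x => (g x * pdf x)%:E).
  apply: (@le_integrable _ _ _ mu setT measurableT _
    (fun x => (K * (1 + s ^+ 2))%:E * ((1 + x ^+ 2) * pdf x)%:E)%E).
  - exact/measurable_EFinP/measurable_funM.
  - move=> x _; rewrite -EFinM !abse_EFin lee_fin mulrA !normrM.
    rewrite ler_wpM2r//.
    apply: (@le_trans _ _ (K * (1 + s ^+ 2) * (1 + x ^+ 2))); last first.
      by rewrite -!normrM ler_norm.
    apply: le_trans (ler_normB _ _) _; rewrite (normrM x) (normrM (s ^+ 2)).
    have -> : K * (1 + s ^+ 2) * (1 + x ^+ 2) =
      K * (1 + x ^+ 2) + s ^+ 2 * (K * (1 + x ^+ 2)) by ring.
    by rewrite (ger0_norm (sqr_ge0 s)) lerD// ler_wpM2l// sqr_ge0.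
  - by apply: integrableZl => //; exact: integrable_sqr_normal_pdf.
have int0 : (\int[mu]_x (g x * pdf x)%:E = 0)%E.
  have [C CP] := sqr_normal_pdf_bounded s_gt0.
  (* Since the derivative of [pdf] is -(x/s^2) [pdf], this product is a primitive of [g * pdf]. *)
  apply: (@integral_derive_eq0 _ (fun x => - s ^+ 2 * (h x * pdf x)) _
    (s ^+ 2 * (K * C))).
  - move=> x; have dhx := dh x; have dp := is_derive_normal_pdf s_gt0 x.
    apply: is_derive_eq; rewrite /GRing.scale /= /g.
    by field.
  - move=> x; apply: cvgM; first exact: cg.
    exact: continuous_normal_pdf.
  - exact: igp.
  - move=> x; rewrite mulNr normrN (normrM (s ^+ 2)) (normrM (h x)).
    rewrite (ger0_norm (sqr_ge0 s)) mulrCA.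
    rewrite ler_wpM2l ?sqr_ge0// mulrA.
    apply: (@le_trans _ _ (K * (1 + x ^+ 2) * `|pdf x|)).
      by rewrite ler_wpM2r.
    rewrite -mulrA ger0_norm ?normal_pdf_ge0// ler_wpM2l//.
    by have := le_trans (normr_ge0 _) (h'K 0); rewrite expr0n/= addr0 mulr1.
rewrite integral_normal_prob//; last first.
  by apply: measurable_funD => //.
under eq_integral do rewrite mulrDl EFinD.
rewrite integralD//=; last first.
  under eq_fun do rewrite EFinM.
  by apply: integrableZl => //; exact: integrable_normal_pdf.
rewrite int0 add0e.
under eq_integral do rewrite EFinM.
rewrite integralZl//; last exact: integrable_normal_pdf.
by rewrite integral_normal_pdf mule1.
Qed.

(** Second moments are a Stein identity too: for h(x) = 2uc + c^2 x, the square is x h - s^2 h' plus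
    the claimed value. *)
Lemma integral_normal_affine_sqr (u c : R) :
  (\int[normal_prob 0 s]_x ((u + c * x) ^+ 2)%:E =
   (u ^+ 2 + c ^+ 2 * s ^+ 2)%:E)%E.
Proof.
have E x : (u + c * x) ^+ 2 = x * (2 * u * c + c ^+ 2 * x) - s ^+ 2 * c ^+ 2 +
    (u ^+ 2 + c ^+ 2 * s ^+ 2) by ring.
under eq_integral do rewrite E.
apply: (@normal_stein (fun x => 2 * u * c + c ^+ 2 * x) (cst (c ^+ 2))
  (2 * `|u * c| + c ^+ 2)).
- move=> x; apply: is_derive_eq; rewrite /GRing.scale /= /cst.
  by ring.
- by move=> x; exact: cvg_cst.
- move=> x; rewrite -normrM.
  have -> : x * (2 * u * c + c ^+ 2 * x) = 2 * (u * c * x) + c ^+ 2 * x ^+ 2 by ring.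
  apply: le_trans (ler_normD _ _) _.
  rewrite (normrM 2) (normrM _ x) (normrM u) (ger0_norm (_ : 0 <= 2)) //.
  rewrite (ger0_norm (mulr_ge0 (sqr_ge0 c) (sqr_ge0 x))).
  have := normr_ge0 u; have := normr_ge0 c; have := normr_ge0 x.
  have := sqr_ge0 c; have := sqr_ge0 (`|x| - 1).
  rewrite -(real_normK (num_real x)).
  set A := `|u|; set B := `|c|; set C := `|x|; set D := c ^+ 2.
  move=> h1 D0 C0 B0 A0.
  have AB : 0 <= A * B by exact: mulr_ge0.
  have CC : C <= 1 + C ^+ 2 by nra.
  have := ler_wpM2l AB CC. nra.
- move=> x; rewrite /= ger0_norm ?sqr_ge0//.
  have := sqr_ge0 c; have := sqr_ge0 x; have := normr_ge0 (u * c); nra.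
- by move=> x; rewrite /= -E sqr_ge0.
Qed.

(** [psi] is the Stein integrand of (ax + b)/q, and the last equation says that its mean is 0,
    because 1 + x^2 has mean 1 + s^2. The bound on [psi] guarantees that the shifted integrand is
    nonnegative. *)
Lemma integral_normal_stein_ratio (a b c K : R) :
  (forall x, 0 <= a * x ^+ 2 + 2 * b * x + c) -> 0 <= a ->
  (1 + a) * (1 + 3 * s ^+ 2) <= K ->
  let q x := 1 + (a * x ^+ 2 + 2 * b * x + c) in
  let psi x := x * ((a * x + b) / q x) -
     s ^+ 2 * (a / q x - 2 * ((a * x + b) / q x) ^+ 2) in
  (forall x, `|psi x| <= K * (1 + x ^+ 2)) /\
  (\int[normal_prob 0 s]_x (psi x + K * (1 + x ^+ 2))%:E =
    (K * (1 + s ^+ 2))%:E)%E.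
Proof.
move=> q0 a0 hK q psi.
have q1 x : 1 <= q x by rewrite lerDl.
have qn0 x : q x != 0 by rewrite gt_eqF// (lt_le_trans _ (q1 x)).
pose f x := (a * x + b) / q x.
pose f' x := a / q x - 2 * (f x) ^+ 2.
(* Discriminant of a nonnegative quadratic, evaluated at its vertex. If a = 0 and b is nonzero, the
   point -(c + 1)/(2b) would give the value -1. *)
have disc : b ^+ 2 <= a * c.
  have [a_gt0|a_le0] := ltP 0 a.
    have := q0 (- b / a).
    have -> : a * (- b / a) ^+ 2 + 2 * b * (- b / a) + c = (a * c - b ^+ 2) / a.
      by field; exact: lt0r_neq0.
    by rewrite pmulr_lge0 ?invr_gt0// subr_ge0.
  have a_eq0 : a = 0 by apply/eqP; rewrite eq_le a_le0.
  have [->|bn0] := eqVneq b 0; first by rewrite a_eq0 expr0n mul0r.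
  have := q0 (- (c + 1) / (2 * b)); rewrite a_eq0 mul0r add0r.
  rewrite mulrC divfK ?mulf_neq0//; lra.
(* By the discriminant bound, (ax + b)^2 = a(q - 1) + b^2 - ac <= a(q - 1). *)
have f2 x : (f x) ^+ 2 <= a / q x.
  rewrite /f expr_div_n ler_pdivrMr ?exprn_gt0 ?(lt_le_trans _ (q1 x))//.
  rewrite expr2 (mulrA _ (q x)) divfK//.
  apply: (@le_trans _ _ (a * (q x - 1))); last first.
    by rewrite ler_wpM2l// gerBl.
  by rewrite /q; nra.
have aq x : 0 <= a / q x <= a.
  rewrite divr_ge0//= ?(le_trans _ (q1 x))//.
  by rewrite ler_pdivrMr ?(lt_le_trans _ (q1 x))// ler_peMr.
have f1 x : `|f x| <= 1 + a.
  rewrite -(@ler_pXn2r _ 2)// ?nnegrE// ?addr_ge0//.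
  rewrite real_normK ?num_real//.
  by have := f2 x; have /andP[] := aq x; nra.
have f'b x : `|f' x| <= 3 * a.
  rewrite /f'; have := f2 x; have /andP[] := aq x; have := sqr_ge0 (f x).
  by rewrite ler_norml => *; apply/andP; split; nra.
have s2 : 0 <= s ^+ 2 by exact: sqr_ge0.
have xn (x : R) : `|x| <= 1 + x ^+ 2.
  by rewrite -(real_normK (num_real x)); have := sqr_ge0 (`|x| - 1); nra.
have psiE x : psi x = x * f x - s ^+ 2 * f' x by [].
have psi_le x : `|psi x| <= K * (1 + x ^+ 2).
  rewrite psiE; apply: le_trans (ler_normB _ _) _.
  rewrite (normrM x) (normrM (s ^+ 2)) (ger0_norm s2).
  apply: (@le_trans _ _ ((1 + x ^+ 2) * (1 + a) + s ^+ 2 * (3 * a))).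
    by rewrite lerD// ?ler_wpM2l// ler_pM.
  apply: (@le_trans _ _ ((1 + a) * (1 + 3 * s ^+ 2) * (1 + x ^+ 2))).
    have := sqr_ge0 x; have := mulr_ge0 s2 a0.
    set y := x ^+ 2 => h y0.
    have := mulr_ge0 h y0; have := mulr_ge0 s2 y0; nra.
  by rewrite ler_wpM2r// addr_ge0// sqr_ge0.
split=> //.
(* Up to a constant, the shift K(1 + x^2) is the Stein integrand of Kx, so one application to f + Kx
   settles both. *)
have E x : psi x + K * (1 + x ^+ 2) = x * (f x + K * x) - s ^+ 2 * (f' x + K) +
  K * (1 + s ^+ 2) by rewrite psiE; ring.
have K0 : 0 <= K.
  by apply: le_trans hK; rewrite mulr_ge0// addr_ge0// mulr_ge0.
under eq_integral do rewrite E.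
have cq : continuous q.
  move=> x; apply: cvgD; first exact: cvg_cst.
  apply: cvgD; last exact: cvg_cst.
  apply: cvgD; apply: cvgM; try exact: cvg_cst; last exact: cvg_id.
  exact: exprn_continuous.
have cf : continuous f.
  move=> x; apply: cvgM; last by apply: cvgV => //; exact: cq.
  apply: cvgD; last exact: cvg_cst.
  by apply: cvgM; [exact: cvg_cst|exact: cvg_id].
have aK : 1 + a <= K.
  apply: le_trans hK; rewrite ler_peMr ?addr_ge0//.
  by rewrite lerDl mulr_ge0.
apply: (@normal_stein _ _ (2 * K + 3 * a)) => //.
- move=> x; rewrite /f.
  have dq : is_derive x 1 q (2 * a * x + 2 * b).
    apply: is_derive_eq; rewrite /GRing.scale /=; ring.
  have dqV := @is_deriveV R q x _ 1 (qn0 x) dq.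
  apply: is_derive_eq; rewrite /GRing.scale /= /f' /f.
  field; exact: qn0.
- move=> x; apply: cvgD; last exact: cvg_cst.
  apply: cvgB; apply: cvgM; try exact: cvg_cst.
    by apply: cvgV => //; exact: cq.
  exact: (continuous_comp (cf x) (@exprn_continuous _ 2 _)).
- move=> x; rewrite -normrM mulrDr; apply: le_trans (ler_normD _ _) _.
  have -> : x * (K * x) = K * x ^+ 2 by ring.
  rewrite (ger0_norm (mulr_ge0 K0 (sqr_ge0 x))) normrM.
  have h1 : `|x| * `|f x| <= (1 + x ^+ 2) * (1 + a) by rewrite ler_pM.
  have := sqr_ge0 x; nra.
- move=> x; apply: le_trans (ler_normD _ _) _.
  rewrite (ger0_norm K0); have := f'b x; have := sqr_ge0 x; nra.
- by move=> x; rewrite -E -lerBlDr sub0r lerNl (le_trans _ (psi_le x))// -normrN ler_norm.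
Qed.

End normal_stein.

(** * Independence and Tonelli *)

(** The joint law agrees with the product of the marginals on rectangles, hence everywhere;
    Tonelli's theorem then splits the integral. *)
Lemma integral_independent (R : realType) (d d1 d2 : measure_display)
    (T : measurableType d) (T1 : measurableType d1) (T2 : measurableType d2)
    (P : probability T R) (Y : {RV P >-> T1}) (Z : {RV P >-> T2}) 
    (f : T1 * T2 -> \bar R) :
  (forall A B, measurable A -> measurable B ->
    P (Y @^-1` A `&` Z @^-1` B) = P (Y @^-1` A) * P (Z @^-1` B))%E ->
  measurable_fun setT f -> (forall z, 0 <= f z)%E ->
  (\int[P]_w f (Y w, Z w) = \int[P]_w \int[distribution P Y]_y f (y, Z w))%E.
Proof.
move=> indep mf f0.
have mYZ : measurable_fun setT (fun w => (Y w, Z w)).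
  exact/measurable_fun_pair.
pose YZ : {RV P >-> (T1 * T2)%type} := HB.pack (fun w => (Y w, Z w))
  (isMeasurableFun.Build _ _ _ _ _ mYZ).
have -> : (\int[P]_w f (Y w, Z w) = \int[distribution P YZ]_z f z)%E.
  by rewrite ge0_integral_distribution.
transitivity (\int[(distribution P Y \x distribution P Z)%E]_z f z)%E.
  apply: eq_measure_integral => /= A mA _; apply/esym.
  by apply: product_measure_unique => // B C mB mC; exact: indep.
rewrite fubini_tonelli1// fubini_tonelli//.
rewrite ge0_integral_distribution//.
- exact: measurable_fun_fubini_tonelli_G.
- by move=> y; apply: integral_ge0.
Qed.

Section generated.
Variables (R : realType) (disp : measure_display) (T : measurableType disp).
Variables (P : probability T R) (I : finType).
Implicit Types (X : I -> {RV P >-> R}) (J : {set I}).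

(** The variables indexed by [J] are kept as a sub-sigma-algebra of [T] rather than bundled into a
    random vector. Depending on them alone becomes measurability for this coarser structure. *)
Definition generators X J : set (set T) :=
  [set B | exists (i : I) (A : set R), [/\ i \in J, measurable A & B = X i @^-1` A]].

Lemma generators_measurable X J B : <<s generators X J >> B -> measurable B.
Proof.
move: B; apply: smallest_sub; first exact: sigma_algebra_measurable.
move=> _ [i [A [_ mA ->]]]; exact: measurable_funPTI.
Qed.

Lemma measurable_generators X J i : i \in J ->
  measurable_fun setT (X i : g_sigma_algebraType (generators X J) -> R).
Proof.
move=> iJ _ A mA; rewrite setTI; apply: sub_gen_smallest.
by exists i, A.
Qed.

(** Finite intersections of preimages form a pi-system generating the sigma-algebra. On it the
    measures P(. and X_i in A) and P(X_i in A) P coincide, so they coincide on everything it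
    generates. *)
Lemma mutually_independent_generators X J i A B :
  mutually_independent X -> i \notin J -> measurable A ->
  <<s generators X J >> B ->
  P (X i @^-1` A `&` B) = (P (X i @^-1` A) * P B)%E.
Proof.
move=> indep iJ mA.
pose Pi : set (set T) := [set C | exists A : I -> set R,
  (forall k, measurable (A k)) /\ C = \bigcap_(k in [set` J]) (X k @^-1` A k)].
have PiT : Pi setT.
  exists (fun=> setT); split => //.
  by apply/seteqP; split => // x _ k _.
have sPi : <<s generators X J >> `<=` <<s Pi >>.
  apply: smallest_sub; first exact: smallest_sigma_algebra.
  move=> _ [k [C [kJ mC ->]]]; apply: sub_gen_smallest.
  exists (fun l => if l == k then C else setT); split.
    by move=> l; case: ifP.
  apply/seteqP; split => [x Cx l _|x /(_ k kJ)] /=.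
    by case: eqP => // ->.
  by rewrite eqxx.
have mX k C : measurable C -> measurable (X k @^-1` C).
  by move=> mC; exact: measurable_funPTI.
have Pim C : Pi C -> measurable C.
  move=> [A' [mA' ->]]; apply: fin_bigcap_measurable => // k _.
  exact: mX.
have mXA := mX i _ mA.
move=> /sPi sB.
rewrite setIC.
have fc : P (X i @^-1` A) \is a fin_num by exact: fin_num_measure.
have c0 : 0 <= fine (P (X i @^-1` A)) by exact: fine_ge0.
have msc C : mscale (NngNum c0) P C = (P (X i @^-1` A) * P C)%E.
  by rewrite /mscale /= fineK.
rewrite -msc.
rewrite -[LHS]/(mrestr P mXA B).
apply: (@g_sigma_algebra_measure_unique _ R T Pi _ (fun=> setT) _ _
  (mrestr P mXA) (mscale (NngNum c0) P)) => //.
- by rewrite bigcup_const//; exists 0%N.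
- move=> _ _ [A1 [mA1 ->]] [A2 [mA2 ->]].
  exists (fun k => A1 k `&` A2 k); split; first by move=> k; exact: measurableI.
  by rewrite -bigcapI; apply: eq_bigcapr => k _; rewrite preimage_setI.
- move=> C [A' [mA' CE]].
  transitivity (P (X i @^-1` A) * P C)%E; last exact/esym/msc.
  rewrite -[LHS]/(P (C `&` X i @^-1` A)) CE.
  pose A2 k := if k == i then A else A' k.
  have mA2 k : measurable (A2 k) by rewrite /A2; case: ifP.
  have h1 := indep (i |: J) A2 mA2.
  have h2 := indep J A' mA'.
  rewrite h2.
  rewrite (_ : _ `&` _ = \bigcap_(k in [set` i |: J]) (X k @^-1` A2 k)).
    rewrite h1 big_setU1//= /A2 eqxx; congr (_ * _)%E.
    apply: eq_bigr => k kJ; case: eqP => // ki.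
    by move: iJ; rewrite -ki kJ.
  apply/seteqP; split => [x [h Ax] k /=|x h].
    rewrite in_setU1 /A2; case: eqP => [->//|_ /= kJ]; exact: h.
  split.
    move=> k /= kJ; have := h k; rewrite /= in_setU1 kJ orbT => /(_ isT).
    rewrite /A2; case: eqP => // ki.
    by move: iJ; rewrite -ki kJ.
  by have := h i; rewrite /= in_setU1 eqxx => /(_ isT); rewrite /A2 eqxx.
- move=> _ /=; rewrite /mrestr setTI.
  by rewrite ltey_eq fc.
Qed.

End generated.

Section subsigma.
Variables (R : realType) (disp : measure_display) (T : measurableType disp).
Variables (P : probability T R).

Lemma integral_probability_cst (r : R) : (\int[P]_w r%:E = r%:E)%E.
Proof.
rewrite integral_cst// -[RHS]mule1; congr (_ * _)%E; exact: probability_setT.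
Qed.

Lemma measurable_id_subsigma (G : set (set T)) : <<s G >> `<=` measurable ->
  measurable_fun setT (id : T -> g_sigma_algebraType G).
Proof. by move=> GS _ A mA; rewrite setTI preimage_id; exact: GS. Qed.

(** The second random variable is the identity of [T], read as a map into [T] with the coarser
    sigma-algebra. This gives conditional integration without conditional expectations. *)
Lemma integral_subsigma_independent (d1 : measure_display)
    (T1 : measurableType d1) (Y : {RV P >-> T1}) (G : set (set T))
    (f : T1 * g_sigma_algebraType G -> \bar R) :
  <<s G >> `<=` measurable ->
  (forall A B, measurable A -> <<s G >> B ->
    P (Y @^-1` A `&` B) = P (Y @^-1` A) * P B)%E ->
  measurable_fun setT f -> (forall z, 0 <= f z)%E ->
  (\int[P]_w f (Y w, w) = \int[P]_w \int[distribution P Y]_y f (y, w))%E.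
Proof.
move=> GS indep mf f0.
pose Z : {RV P >-> g_sigma_algebraType G} :=
  HB.pack (id : T -> g_sigma_algebraType G)
  (isMeasurableFun.Build _ _ _ _ _ (measurable_id_subsigma GS)).
exact: (@integral_independent _ _ _ _ _ _ _ P Y Z).
Qed.

Lemma integral_subsigmas_independent (G1 G2 : set (set T))
    (f : g_sigma_algebraType G1 * g_sigma_algebraType G2 -> \bar R) :
  <<s G1 >> `<=` measurable -> <<s G2 >> `<=` measurable ->
  (forall A B, <<s G1 >> A -> <<s G2 >> B -> P (A `&` B) = P A * P B)%E ->
  measurable_fun setT f -> (forall z, 0 <= f z)%E ->
  (\int[P]_w f (w, w) = \int[P]_w \int[P]_y f (y, w))%E.
Proof.
move=> GS1 GS2 indep mf f0.
pose Y : {RV P >-> g_sigma_algebraType G1} :=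
  HB.pack (id : T -> g_sigma_algebraType G1)
  (isMeasurableFun.Build _ _ _ _ _ (measurable_id_subsigma GS1)).
rewrite (@integral_subsigma_independent _ _ Y _ f)//.
apply: eq_integral => w _.
rewrite ge0_integral_distribution//.
apply: (measurableT_comp mf); exact: pair2_measurable.
Qed.

End subsigma.

Section iid_normal.
Variables (R : realType) (disp : measure_display) (T : measurableType disp).
Variables (P : probability T R) (I : finType) (X : I -> {RV P >-> R}) (v : R).
Hypotheses (v_gt0 : 0 < v) (lawX : iid_centered_normal X v).

(* [normal_prob] lives on [measurableTypeR R] and [distribution P (X i)] on [R]:
   same measurable sets but different displays, hence the pushforward by the
   identity. *)
Lemma integral_distribution_normal (i : I) (f : R -> \bar R) :
  measurable_fun setT f -> (forall z, 0 <= f z)%E ->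
  (\int[distribution P (X i)]_y f y =
   \int[normal_prob 0 (Num.sqrt v)]_y f y)%E.
Proof.
move=> mf f0; have [_ law] := lawX.
have mid : measurable_fun setT (id : measurableTypeR R -> R) by move=> _ A; rewrite setTI.
transitivity (\int[pushforward (normal_prob 0 (Num.sqrt v))
   (id : measurableTypeR R -> R)]_y f y)%E.
  by apply: eq_measure_integral => A mA _; exact: law.
by rewrite ge0_integral_pushforward.
Qed.

(** Integrates out one variable while the others stay frozen in [w]. *)
Lemma integral_iid_peel (i : I) (J : {set I})
    (f : R * g_sigma_algebraType (generators X J) -> \bar R) :
  i \notin J -> measurable_fun setT f -> (forall z, 0 <= f z)%E ->
  (\int[P]_w f (X i w, w) =
   \int[P]_w \int[normal_prob 0 (Num.sqrt v)]_y f (y, w))%E.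
Proof.
move=> iJ mf f0; have [indep law] := lawX.
rewrite (@integral_subsigma_independent _ _ _ P _ _ (X i) _ f)//.
- apply: eq_integral => w _; rewrite integral_distribution_normal//.
  by apply: (measurableT_comp mf); exact: pair2_measurable.
- by move=> A; exact: generators_measurable.
- by move=> A B mA sB; exact: (mutually_independent_generators indep iJ mA sB).
Qed.

(** Variables are peeled off one by one, the remaining affine form acting as the constant term, so
    no cross terms appear. This serves the test point, the noise, and the second moment of a single
    entry of X. *)
Lemma integral_iid_affine_sqr (a : R) (c : I -> R) :
  (\int[P]_w ((a + \sum_i c i * X i w) ^+ 2)%:E =
   (a ^+ 2 + v * \sum_i c i ^+ 2)%:E)%E.
Proof.
suff h (s : seq I) : uniq s ->
    (\int[P]_w ((a + \sum_(i <- s) c i * X i w) ^+ 2)%:E =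
     (a ^+ 2 + v * \sum_(i <- s) c i ^+ 2)%:E)%E.
  by apply: h; exact: index_enum_uniq.
elim: s => [_|i s IH /= /andP[iNs us]].
  under eq_integral do rewrite big_nil addr0.
  by rewrite integral_probability_cst big_nil mulr0 addr0.
pose J := [set j in s].
pose u (w : g_sigma_algebraType (generators X J)) := a + \sum_(j <- s) c j * X j w.
have mu : measurable_fun setT u.
  apply: measurable_funD => //.
  suff h (s' : seq I) : {subset s' <= J} -> measurable_fun setT
      (fun w : g_sigma_algebraType (generators X J) => \sum_(j <- s') c j * X j w).
    by apply: h => j; rewrite inE.
  elim: s' => [|j s' IHs] sJ.
    by under eq_fun do rewrite big_nil; exact: measurable_cst.
  under eq_fun do rewrite big_cons.
  apply: measurable_funD.
    apply: measurable_funM => //; apply: measurable_generators.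
    by apply: sJ; rewrite inE eqxx.
  by apply: IHs => k ks; apply: sJ; rewrite inE ks orbT.
under eq_integral do rewrite big_cons addrCA addrC.
rewrite (@integral_iid_peel i J (fun z => ((u z.2 + c i * z.1) ^+ 2)%:E)).
- transitivity (\int[P]_w (((u w) ^+ 2)%:E + (c i ^+ 2 * v)%:E))%E.
    apply: eq_integral => w _ /=.
    have := integral_normal_affine_sqr (_ : 0 < Num.sqrt v) (u w) (c i).
    by rewrite sqr_sqrtr ?ltW// sqrtr_gt0; apply.
  rewrite ge0_integralD//=.
  + rewrite IH// integral_probability_cst -EFinD big_cons; congr EFin; ring.
  + by move=> w _; rewrite lee_fin sqr_ge0.
  + apply/measurable_EFinP/measurable_funX/measurable_funD => //.
    by apply: measurable_sum => j; apply: measurable_funM.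
  + by move=> w _; rewrite lee_fin mulr_ge0 ?sqr_ge0// ltW.
- by rewrite inE.
- apply/measurable_EFinP/measurable_funX/measurable_funD.
    exact: measurableT_comp mu measurable_snd.
  by apply: measurable_funM => //; exact: measurable_fst.
- by move=> z; rewrite lee_fin sqr_ge0.
Qed.

End iid_normal.

(** * Ridge-regularized Gram matrices *)

Section quadratic_forms.
Variable R : realFieldType.

Lemma mx11_sum n (u v : 'cV[R]_n) : (u^T *m v) 0 0 = \sum_i u i 0 * v i 0.
Proof. by rewrite mxE; apply: eq_bigr => i _; rewrite mxE. Qed.

Lemma mxtrace_trmx_mul m n (A B : 'M[R]_(m, n)) :
  \tr (A^T *m B) = \sum_i \sum_j A i j * B i j.
Proof.
rewrite /mxtrace exchange_big /=; apply: eq_bigr => j _.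
by rewrite mxE; apply: eq_bigr => i _; rewrite mxE.
Qed.

Lemma mxtrace_mul_tr m n (A : 'M[R]_(m, n)) (B : 'M[R]_n) :
  \tr (A^T *m A *m B) = \sum_i (row i A *m B *m (row i A)^T) 0 0.
Proof.
rewrite -mulmxA mxtrace_mulC /mxtrace; apply: eq_bigr => i _.
rewrite -row_mul !mxE; apply: eq_bigr => k _; by rewrite !mxE.
Qed.

Lemma mxtrace_trmx_mul_ge0 m n (A : 'M[R]_(m, n)) : 0 <= \tr (A^T *m A).
Proof.
rewrite mxtrace_trmx_mul; do 2! apply: sumr_ge0 => ? _.
by rewrite -expr2 sqr_ge0.
Qed.

End quadratic_forms.

Section ridge.
Variables (R : realFieldType) (n d : nat).
Implicit Types (X : 'M[R]_(n, d)) (t : R).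

Definition ridge X t : 'M[R]_d := X^T *m X + t%:M.

Lemma ridge_tr X t : (ridge X t)^T = ridge X t.
Proof. by rewrite /ridge linearD /= trmx_mul trmxK tr_scalar_mx. Qed.

(** A row vector v killed by the matrix satisfies 0 = |X v^T|^2 + t |v|^2. *)
Lemma ridge_unit X t : 0 < t -> ridge X t \in unitmx.
Proof.
move=> t0; rewrite -row_free_unit; apply: inj_row_free => v vA.
have : \tr (v *m ridge X t *m v^T) = 0 by rewrite vA mul0mx mxtrace0.
rewrite /ridge mulmxDr mulmxDl mxtraceD mul_mx_scalar -scalemxAl mxtraceZ.
have -> : v *m (X^T *m X) *m v^T = (X *m v^T)^T *m (X *m v^T).
  by rewrite trmx_mul trmxK !mulmxA.
have h1 := mxtrace_trmx_mul_ge0 (X *m v^T).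
have h2 := mxtrace_trmx_mul_ge0 v^T; rewrite trmxK in h2.
move=> h; have {}h : \tr (v *m v^T) = 0.
  have : t * \tr (v *m v^T) = 0 by have := mulr_ge0 (ltW t0) h2; lra.
  by move/eqP; rewrite mulf_eq0 gt_eqF//= => /eqP.
apply/rowP => j; rewrite mxE.
move: h; rewrite -{1}(trmxK v) mxtrace_trmx_mul.
rewrite exchange_big big_ord1 /= => /psumr_eq0P h.
have : v^T j 0 * v^T j 0 = 0 by apply: h => // i _; rewrite -expr2 sqr_ge0.
by move/eqP; rewrite mulf_eq0 orbb mxE => /eqP.
Qed.

Section inverse.
Variables (X : 'M[R]_(n, d)) (t : R).
Hypothesis t_gt0 : 0 < t.
Let B := invmx (ridge X t).
Let uA : ridge X t \in unitmx := ridge_unit X t_gt0.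

Lemma ridgeV_tr : B^T = B.
Proof. by rewrite /B trmx_inv ridge_tr. Qed.

Lemma gram_ridgeV : X^T *m X *m B = 1%:M - t *: B.
Proof.
rewrite -[X^T *m X](addrK t%:M) -/(ridge X t) mulmxBl mulmxV// mul_scalar_mx.
by [].
Qed.

(** Expand B = B (G + t) B. Being a sum of two squares, B is positive semidefinite, and the second
    square alone bounds t tr(B^2) by tr B; no spectral theorem is involved. *)
Lemma ridgeV_decomp : B = (X *m B)^T *m (X *m B) + t *: (B *m B).
Proof.
rewrite trmx_mul ridgeV_tr -mulmxA (mulmxA X^T) gram_ridgeV mulmxBr mulmx1.
by rewrite -scalemxAr subrK.
Qed.

Lemma ridgeV_form_ge0 (v : 'cV[R]_d) : 0 <= (v^T *m B *m v) 0 0.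
Proof.
rewrite -trace_mx11 [in X in 0 <= X]ridgeV_decomp.
rewrite mulmxDr mulmxDl mxtraceD addr_ge0//.
  rewrite (_ : _ *m v = (X *m B *m v)^T *m (X *m B *m v)).
    exact: mxtrace_trmx_mul_ge0.
  by rewrite !trmx_mul !mulmxA.
rewrite -scalemxAr -scalemxAl mxtraceZ mulr_ge0 ?(ltW t_gt0)//.
rewrite (_ : _ *m v = (B *m v)^T *m (B *m v)).
  exact: mxtrace_trmx_mul_ge0.
by rewrite trmx_mul ridgeV_tr !mulmxA.
Qed.

Lemma ridgeV_sqr : \tr (B *m B) = \sum_i \sum_j B i j ^+ 2.
Proof. by rewrite -{1}ridgeV_tr mxtrace_trmx_mul. Qed.

Lemma ridgeV_sqr_ge0 : 0 <= \tr (B *m B).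
Proof. by rewrite -{1}ridgeV_tr mxtrace_trmx_mul_ge0. Qed.

Lemma ridgeV_sqr_le : t * \tr (B *m B) <= \tr B.
Proof.
rewrite [leRHS](_ : _ = \tr ((X *m B)^T *m (X *m B) + t *: (B *m B))); last first.
  by rewrite -ridgeV_decomp.
by rewrite mxtraceD mxtraceZ lerDr mxtrace_trmx_mul_ge0.
Qed.

Lemma ridgeV_trace_ge0 : 0 <= \tr B.
Proof. by apply: le_trans ridgeV_sqr_le; rewrite mulr_ge0 ?ridgeV_sqr_ge0 ?ltW. Qed.

Lemma gram_ridgeV_trace : \tr (X^T *m X *m B) = d%:R - t * \tr B.
Proof. by rewrite gram_ridgeV linearB /= mxtrace1 mxtraceZ. Qed.

Lemma gram_ridgeV_sqr_trace :
  \tr (X^T *m X *m (B *m B)) = \tr B - t * \tr (B *m B).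
Proof.
by rewrite mulmxA gram_ridgeV mulmxBl mul1mx linearB /= -scalemxAl mxtraceZ.
Qed.

Lemma ridgeV_trace_le : t * \tr B <= d%:R.
Proof.
rewrite -subr_ge0 -gram_ridgeV_trace mxtrace_mul_tr.
apply: sumr_ge0 => i _.
by have := ridgeV_form_ge0 (row i X)^T; rewrite trmxK.
Qed.

Let formE (v w : 'cV[R]_d) (x : R) :
  ((v + x *: w)^T *m B *m (v + x *: w)) 0 0 =
  (v^T *m B *m v) 0 0 + 2 * x * (v^T *m B *m w) 0 0 + x ^+ 2 * (w^T *m B *m w) 0 0.
Proof.
have -> : (v + x *: w)^T = v^T + x *: w^T by rewrite linearD linearZ.
have sym : (w^T *m B *m v) 0 0 = (v^T *m B *m w) 0 0.
  transitivity ((w^T *m B *m v)^T 0 0); first by rewrite [RHS]mxE.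
  by rewrite !trmx_mul trmxK ridgeV_tr mulmxA.
rewrite !mulmxDr !mulmxDl -!scalemxAl -!scalemxAr -?scalemxAl.
move: (v^T *m B *m v) (v^T *m B *m w) (w^T *m B *m w) (w^T *m B *m v) sym.
by move=> a b c e sym; rewrite !mxE sym; ring.
Qed.

Lemma delta_formE (i j : 'I_d) :
  ((delta_mx i 0 : 'cV_d)^T *m B *m (delta_mx j 0 : 'cV_d)) 0 0 = B i j.
Proof. by rewrite trmx_delta -rowE -colE !mxE. Qed.

Lemma ridgeV_diag_ge0 i : 0 <= B i i.
Proof. by rewrite -delta_formE ridgeV_form_ge0. Qed.

Lemma ridgeV_diag_le i : B i i <= \tr B.
Proof.
rewrite /mxtrace (bigD1 i)//= lerDl; apply: sumr_ge0 => j _.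
exact: ridgeV_diag_ge0.
Qed.

(** Positivity of the form at e_i + e_j and e_i - e_j gives 2 |B_ij| <= B_ii + B_jj. *)
Lemma ridgeV_entry_le i j : `|B i j| <= \tr B.
Proof.
have h x := ridgeV_form_ge0 ((delta_mx i 0 : 'cV_d) + x *: (delta_mx j 0 : 'cV_d)).
have := h 1; have := h (-1); rewrite !formE !delta_formE.
have := ridgeV_diag_le i; have := ridgeV_diag_le j.
by rewrite ler_norml => *; apply/andP; split; lra.
Qed.

(** For u a row of X with entry j erased and x that entry, this exhibits the coefficients a, b, c of
    the one-variable Stein identity. *)
Lemma ridgeV_form_shift (u : 'cV[R]_d) (j : 'I_d) (x : R) :
  let r := u + x *: delta_mx j 0 in
  (r^T *m B *m r) 0 0 = B j j * x ^+ 2 + 2 * (B *m u) j 0 * x + (u^T *m B *m u) 0 0.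
Proof.
move=> r; rewrite /r formE delta_formE.
have -> : (u^T *m B *m (delta_mx j 0 : 'cV_d)) 0 0 = (B *m u) j 0.
  by rewrite -colE -[in LHS]ridgeV_tr -trmx_mul !mxE.
ring.
Qed.

Lemma ridgeV_mul_shift (u : 'cV[R]_d) (j : 'I_d) (x : R) :
  (B *m (u + x *: delta_mx j 0)) j 0 = B j j * x + (B *m u) j 0.
Proof.
rewrite mulmxDr -scalemxAr -colE !mxE; ring.
Qed.

End inverse.
End ridge.

(** * Rank-one updates and the summed Stein identity *)

Section leave_one_out.
Variables (R : realFieldType) (n d : nat) (X : 'M[R]_(n, d)) (t : R).
Hypothesis t_gt0 : 0 < t.

(** Zeroing a row has the same effect on the Gram matrix as deleting it, and keeps the
    dimensions. *)
Definition zero_row (i : 'I_n) : 'M[R]_(n, d) :=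
  \matrix_(k, l) if k == i then 0 else X k l.

Let B := invmx (ridge X t).

Section row.
Variable i : 'I_n.
Let r : 'cV[R]_d := (row i X)^T.
Let A := ridge (zero_row i) t.
Let C := invmx A.
Let q := 1 + (r^T *m C *m r) 0 0.

Lemma ridge_zero_row : ridge X t = A + r *m r^T.
Proof.
rewrite /A /ridge addrAC; congr (_ + _).
apply/matrixP => a b; rewrite !mxE (bigD1 i)//= big_ord1 !mxE addrC; congr (_ + _).
rewrite [RHS](bigD1 i)//= !mxE eqxx mulr0 add0r.
by apply: eq_bigr => k ki; rewrite !mxE (negbTE ki).
Qed.

Let uA : A \in unitmx. Proof. exact: ridge_unit. Qed.
Let uX : ridge X t \in unitmx. Proof. exact: ridge_unit. Qed.

Lemma loo_denom_gt0 : 0 < q.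
Proof. by rewrite ltr_pwDl// ridgeV_form_ge0. Qed.

Let q_neq0 : q != 0. Proof. exact: lt0r_neq0 loo_denom_gt0. Qed.

Let rCr : r^T *m C *m r = (q - 1)%:M.
Proof. by rewrite [LHS]mx11_scalar /q addrC addrA addNr add0r. Qed.

Lemma ridgeV_row : B *m r = q^-1 *: (C *m r).
Proof.
have h : ridge X t *m (C *m r) = q *: r.
  rewrite ridge_zero_row mulmxDl mulmxA mulmxV// mul1mx.
  rewrite -mulmxA (mulmxA r^T) rCr mul_mx_scalar.
  by rewrite -{1}[r]scale1r -scalerDl addrC subrK.
rewrite -[RHS]/(q^-1 *: (C *m r)) -[C *m r](mulKmx uX) h -scalemxAr scalerA.
by rewrite mulVf// scale1r.
Qed.

Lemma sherman_morrison : C = B + q^-1 *: (C *m r *m (C *m r)^T).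
Proof.
have C_tr : C^T = C by exact: ridgeV_tr.
have h : B *m A = 1%:M - B *m r *m r^T.
  have -> : A = ridge X t - r *m r^T by rewrite ridge_zero_row addrK.
  by rewrite mulmxBr mulVmx// mulmxA.
rewrite trmx_mul C_tr scalemxAl -ridgeV_row mulmxA -{1}(mul1mx C).
have -> : 1%:M = B *m A + B *m r *m r^T by rewrite h subrK.
by rewrite mulmxDl -mulmxA mulmxV// mulmx1.
Qed.

(** Three facts remove C and q: C r / q = B r, 1/q = 1 - r^T B r, and tr C = tr B + q |B r|^2. The
    last one cancels half of the term -2 |B r|^2. *)
Lemma loo_stein_sum (v : R) :
  \sum_j (X i j * ((C *m r) j 0 / q) -
          v * (C j j / q - 2 * ((C *m r) j 0 / q) ^+ 2)) =
  (row i X *m B *m (row i X)^T) 0 0 -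
  v * (\tr B * (1 - (row i X *m B *m (row i X)^T) 0 0) -
       (row i X *m (B *m B) *m (row i X)^T) 0 0).
Proof.
have yE j : (C *m r) j 0 / q = (B *m r) j 0 by rewrite ridgeV_row !mxE mulrC.
have h1 : (row i X *m B *m (row i X)^T) 0 0 = \sum_j X i j * (B *m r) j 0.
  by rewrite -mulmxA mxE; apply: eq_bigr => j _; rewrite mxE.
have h2 : (row i X *m (B *m B) *m (row i X)^T) 0 0 = \sum_j (B *m r) j 0 ^+ 2.
  have -> : row i X *m (B *m B) *m (row i X)^T = (B *m r)^T *m (B *m r).
    by rewrite trmx_mul ridgeV_tr// trmxK !mulmxA.
  by rewrite mx11_sum.
have h3 : 1 - (row i X *m B *m (row i X)^T) 0 0 = q^-1.
  have -> : row i X *m B *m (row i X)^T = q^-1 *: (r^T *m C *m r).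
    by rewrite -mulmxA ridgeV_row -scalemxAr mulmxA trmxK.
  rewrite rCr scale_scalar_mx mxE eqxx mulr1n mulrBr mulr1 mulVf//.
  by rewrite opprB addrC subrK.
have h4 : \tr C = \tr B + q * \sum_j (B *m r) j 0 ^+ 2.
  rewrite {1}sherman_morrison mxtraceD mxtraceZ mxtrace_mulC trace_mx11 mx11_sum.
  congr (_ + _).
  rewrite !mulr_sumr; apply: eq_bigr => j _; rewrite -yE.
  by field.
rewrite h3 h1 h2 sumrB -mulr_sumr sumrB -mulr_suml -mulr_sumr.
rewrite -/(\tr C) h4.
under eq_bigr do rewrite yE.
under [X in _ - _ * (_ - _ * X)]eq_bigr do rewrite yE.
congr (_ - _ * _).
by field.
Qed.

End row.

(** Over all rows, r^T B r sums to tr(GB) = d - t tr B and r^T B^2 r to tr(GB^2) = tr B - t tr(B^2);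
    these produce the -d and the -1 in the coefficient of tr B. *)
Lemma stein_sum (v : R) :
  \sum_i \sum_j (
    let r := (row i X)^T in let C := invmx (ridge (zero_row i) t) in
    let q := 1 + (r^T *m C *m r) 0 0 in
    X i j * ((C *m r) j 0 / q) - v * (C j j / q - 2 * ((C *m r) j 0 / q) ^+ 2)) =
  d%:R - t * \tr B - v * ((n%:R - d%:R - 1) * \tr B
    + t * \tr B ^+ 2 + t * \tr (B *m B)).
Proof.
under eq_bigr do rewrite loo_stein_sum.
rewrite sumrB -mulr_sumr sumrB -mulr_sumr sumrB -!mxtrace_mul_tr.
rewrite gram_ridgeV_trace// gram_ridgeV_sqr_trace// -/B sumr_const card_ord.
ring.
Qed.

End leave_one_out.

(** * The ridge trace for small t *)

Section ridge_limit.
Variables (R : realFieldType) (n d : nat) (X : 'M[R]_(n, d)) (t : R).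
Hypothesis t_gt0 : 0 < t.
Let B := invmx (ridge X t).
Let G := X^T *m X.

(** A kernel vector v of G is an eigenvector of B with eigenvalue 1/t. Since every entry of B is at
    most tr B, |v_j|/t <= tr B * sum_k |v_k|. *)
Lemma ridgeV_trace_singular : G \notin unitmx ->
  exists2 c : R, 0 < c & forall t, 0 < t -> c / t <= \tr (invmx (ridge X t)).
Proof.
rewrite -row_free_unit -kermx_eq0 => /rowV0Pn[v /sub_kermxP vG v_neq0].
have Gv : G *m v^T = 0.
  have GT : G^T = G by rewrite trmx_mul trmxK.
  by rewrite -{1}GT -trmx_mul vG trmx0.
have [j vj] : exists j, v 0 j != 0.
  apply/existsP; apply: contraNT v_neq0 => /existsPn h.
  by apply/eqP/rowP => j; have := h j; rewrite negbK mxE => /eqP.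
pose S := \sum_j `|v 0 j|.
have S_gt0 : 0 < S.
  rewrite /S (bigD1 j)//= ltr_pwDl ?normr_gt0//.
  by apply: sumr_ge0.
exists (`|v 0 j| / S); first by rewrite divr_gt0// normr_gt0.
move=> s s_gt0; have uA := ridge_unit X s_gt0.
have Bv : invmx (ridge X s) *m v^T = s^-1 *: v^T.
  have h : ridge X s *m (s^-1 *: v^T) = v^T.
    rewrite /ridge -scalemxAr mulmxDl Gv add0r mul_scalar_mx scalerA.
    by rewrite mulVf ?scale1r// gt_eqF.
  by rewrite -{1}h mulKmx.
rewrite mulrAC ler_pdivrMr//.
have -> : `|v 0 j| / s = `|(invmx (ridge X s) *m v^T) j 0|.
  by rewrite Bv !mxE normrM mulrC (ger0_norm (_ : 0 <= s^-1))// invr_ge0 ltW.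
rewrite mxE; apply: le_trans (ler_norm_sum _ _ _) _.
rewrite /S mulr_sumr; apply: ler_sum => k _.
by rewrite normrM mxE ler_wpM2r// ridgeV_entry_le.
Qed.

Section regular.
Hypothesis uG : G \in unitmx.

Let uA := ridge_unit X t_gt0.

Lemma gramV_sub : invmx G - B = t *: (invmx G *m B).
Proof.
have h : invmx G = invmx G *m ridge X t *m B by rewrite -mulmxA mulmxV// mulmx1.
rewrite {1}h /ridge mulmxDr mulVmx// mulmxDl mul1mx addrC addKr.
by rewrite mul_mx_scalar -scalemxAl.
Qed.

Lemma gramV_trE : invmx G = (X *m invmx G)^T *m (X *m invmx G).
Proof.
have GT : G^T = G by rewrite trmx_mul trmxK.
by rewrite trmx_mul trmx_inv GT -mulmxA (mulmxA X^T) -/G mulmxV// mulmx1.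
Qed.

(** The difference is t tr(G^-1 B). Writing G^-1 = W^T W with W = X G^-1 turns this trace into a sum
    of values of the form B on the rows of W. *)
Lemma ridgeV_trace_le_gramV : \tr B <= \tr (invmx G).
Proof.
rewrite -subr_ge0 -linearB /= gramV_sub mxtraceZ mulr_ge0 ?(ltW t_gt0)//.
rewrite gramV_trE mxtrace_mul_tr; apply: sumr_ge0 => i _.
by have := ridgeV_form_ge0 X t_gt0 (row i (X *m invmx G))^T; rewrite trmxK.
Qed.

Lemma gramV_trace_ge0 : 0 <= \tr (invmx G).
Proof. by rewrite gramV_trE mxtrace_trmx_mul_ge0. Qed.

(** A crude entrywise bound: its constant depends on X, which is enough for pointwise convergence as
    t tends to 0. *)
Lemma gramV_trace_sub_le : \tr (invmx G) - \tr B <=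
  t * (\sum_i \sum_j `|invmx G i j|) * \tr (invmx G).
Proof.
rewrite -linearB /= gramV_sub mxtraceZ -mulrA ler_wpM2l ?(ltW t_gt0)//.
rewrite mulr_suml; apply: ler_sum => i _; rewrite mxE mulr_suml.
apply: ler_sum => j _; apply: le_trans (ler_norm _) _.
rewrite normrM ler_wpM2l// (le_trans (ridgeV_entry_le _ _ _ _))//.
exact: ridgeV_trace_le_gramV.
Qed.

End regular.
End ridge_limit.

(** * The inverse Wishart trace *)

Lemma measurable_invr (R : realType) : measurable_fun setT (@GRing.inv R).
Proof.
(* Since [0^-1 = 0], [h k] converges to the inverse at [0] too. *)
pose h k (x : R) := x / (x ^+ 2 + k.+1%:R^-1).
have den_gt0 k x : 0 < x ^+ 2 + k.+1%:R^-1 :> R.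
  by rewrite ltr_wpDl ?sqr_ge0// invr_gt0.
apply: (measurable_fun_cvg (h := h)) => [k|x _].
  apply: continuous_measurable_fun => x; apply: cvgM; first exact: cvg_id.
  apply: cvgV; first exact: lt0r_neq0.
  by apply: cvgD; [exact: exprn_continuous|exact: cvg_cst].
have [->|x_neq0] := eqVneq x 0.
  by rewrite invr0 /h; under eq_fun do rewrite mul0r; exact: cvg_cst.
have -> : x^-1 = x / (x ^+ 2 + 0) by rewrite addr0; field.
apply: cvgM; first exact: cvg_cst.
apply: cvgV; first by rewrite addr0 expf_neq0.
by apply: cvgD; [exact: cvg_cst|exact: cvg_harmonic].
Qed.

Section measurable_matrix.
Variables (R : realType) (disp : measure_display) (E : measurableType disp).

Definition measurable_mx m n (M : E -> 'M[R]_(m, n)) :=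
  forall i j, measurable_fun setT (fun w => M w i j).

Lemma measurable_mx_cst m n (A : 'M[R]_(m, n)) : measurable_mx (fun=> A).
Proof. by move=> i j; exact: measurable_cst. Qed.

Lemma measurable_mxD m n (M1 M2 : E -> 'M[R]_(m, n)) :
  measurable_mx M1 -> measurable_mx M2 -> measurable_mx (fun w => M1 w + M2 w).
Proof.
move=> h1 h2 i j; under eq_fun do rewrite mxE.
exact: measurable_funD.
Qed.

Lemma measurable_mxM m n p (M1 : E -> 'M[R]_(m, n)) (M2 : E -> 'M[R]_(n, p)) :
  measurable_mx M1 -> measurable_mx M2 -> measurable_mx (fun w => M1 w *m M2 w).
Proof.
move=> h1 h2 i j; under eq_fun do rewrite mxE.
by apply: measurable_sum => k; exact: measurable_funM.
Qed.

Lemma measurable_mx_tr m n (M : E -> 'M[R]_(m, n)) :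
  measurable_mx M -> measurable_mx (fun w => (M w)^T).
Proof. by move=> h i j; under eq_fun do rewrite mxE; exact: h. Qed.

Lemma measurable_mxZ m n (a : R) (M : E -> 'M[R]_(m, n)) :
  measurable_mx M -> measurable_mx (fun w => a *: M w).
Proof.
by move=> h i j; under eq_fun do rewrite mxE; exact: measurable_funM.
Qed.

Lemma measurable_mx_row m n (M : E -> 'M[R]_(m, n)) i :
  measurable_mx M -> measurable_mx (fun w => row i (M w)).
Proof. by move=> h k j; under eq_fun do rewrite mxE; exact: h. Qed.

Lemma measurable_mxtrace n (M : E -> 'M[R]_n) :
  measurable_mx M -> measurable_fun setT (fun w => \tr (M w)).
Proof. by move=> h; apply: measurable_sum => i; exact: h. Qed.

Lemma measurable_determinant n (M : E -> 'M[R]_n) :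
  measurable_mx M -> measurable_fun setT (fun w => \det (M w)).
Proof.
move=> h; apply: measurable_sum => s; apply: measurable_funM => //.
by apply: measurable_prod => i _; exact: h.
Qed.

Lemma measurable_unitmx n (M : E -> 'M[R]_n) :
  measurable_mx M -> measurable_fun setT (fun w => M w \in unitmx).
Proof.
move=> h; have -> : (fun w => M w \in unitmx) = (fun w => ~~ (\det (M w) == 0)).
  by apply/funext => w; rewrite unitmxE unitfE.
apply: measurable_neg; apply: measurable_fun_eqr => //.
exact: measurable_determinant.
Qed.

(** Cramer's formula applies where the determinant is nonzero, a measurable condition; elsewhere
    [invmx] returns its argument. *)
Lemma measurable_invmx n (M : E -> 'M[R]_n) :
  measurable_mx M -> measurable_mx (fun w => invmx (M w)).
Proof.
move=> h i j.
have -> : (fun w => invmx (M w) i j) =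
    (fun w => if M w \in unitmx then (\det (M w))^-1 * (\adj (M w)) i j else M w i j).
  by apply/funext => w; rewrite /invmx; case: ifP; rewrite ?mxE.
apply: measurable_fun_ifT; [exact: measurable_unitmx| |exact: h].
apply: measurable_funM.
  by apply: measurableT_comp (@measurable_invr R) _; exact: measurable_determinant.
under eq_fun do rewrite mxE /cofactor.
apply: measurable_funM => //; apply: measurable_determinant => a b.
by under eq_fun do rewrite !mxE; exact: h.
Qed.

Lemma measurable_ridge n d (M : E -> 'M[R]_(n, d)) t :
  measurable_mx M -> measurable_mx (fun w => ridge (M w) t).
Proof.
move=> h; apply: measurable_mxD; last exact: measurable_mx_cst.
by apply: measurable_mxM => //; exact: measurable_mx_tr.
Qed.

End measurable_matrix.

Section gaussian_matrix.
Variables (R : realType) (disp : measure_display) (T : measurableType disp).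
Variables (P : probability T R) (n d : nat).
Variables (X : 'I_n * 'I_d -> {RV P >-> R}) (v : R).
Hypotheses (v_gt0 : 0 < v) (lawX : iid_centered_normal X v).
Let M (w : T) : 'M[R]_(n, d) := random_matrix X w.

Lemma measurable_random_matrix : measurable_mx M.
Proof. by move=> i j; under eq_fun do rewrite mxE; exact: measurable_funPT. Qed.

Section stein.
Variable t : R.
Hypothesis t_gt0 : 0 < t.
Let K := (1 + d%:R / t) * (1 + 3 * v).

(** For p = (i, j) this is Y_ij g - v dg/dY_ij with g = (Y B)_ij, written through the leave-one-out
    inverse so that the dependence on Y_ij is explicit. *)
Definition stein_term (Y : 'M[R]_(n, d)) (p : 'I_n * 'I_d) : R :=
  let r := (row p.1 Y)^T in let C := invmx (ridge (zero_row Y p.1) t) in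
  let q := 1 + (r^T *m C *m r) 0 0 in
  Y p.1 p.2 * ((C *m r) p.2 0 / q) - v * (C p.2 p.2 / q - 2 * ((C *m r) p.2 0 / q) ^+ 2).

Lemma measurable_stein_term p : measurable_fun setT (fun w => stein_term (M w) p).
Proof.
case: p => i j; have mM := measurable_random_matrix.
have mr : measurable_mx (fun w => (row i (M w))^T).
  by apply: measurable_mx_tr; exact: measurable_mx_row.
have mC : measurable_mx (fun w => invmx (ridge (zero_row (M w) i) t)).
  apply: measurable_invmx; apply: measurable_ridge => k l.
  under eq_fun do rewrite mxE.
  by case: eqP => _; [exact: measurable_cst|exact: mM].
have mCr := measurable_mxM mC mr.
have mq : measurable_fun setT (fun w => (1 + ((row i (M w))^T^T *m
    invmx (ridge (zero_row (M w) i) t) *m (row i (M w))^T) 0 0)^-1).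
  apply: measurableT_comp (@measurable_invr R) _; apply: measurable_funD => //.
  apply: measurable_mxM => //; apply: measurable_mxM => //.
  exact: measurable_mx_tr.
apply: measurable_funB; apply: measurable_funM => //; first exact: measurable_funM.
apply: measurable_funB; first exact: measurable_funM.
by apply: measurable_funM => //; apply: measurable_funX; exact: measurable_funM.
Qed.

Lemma stein_term_expectation p :
  (forall w, 0 <= stein_term (M w) p + K * (1 + X p w ^+ 2)) /\
  (\int[P]_w (stein_term (M w) p + K * (1 + X p w ^+ 2))%:E = (K * (1 + v))%:E)%E.
Proof.
case: p => i j.
(* [M0] is [M] with entry [(i, j)] erased, so [a], [b], [c] are functions of the
   other entries only. *)
pose J : {set 'I_n * 'I_d} := ~: [set (i, j)].
pose E := g_sigma_algebraType (generators X J).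
pose M0 (w : E) : 'M[R]_(n, d) := \matrix_(k, l) if (k, l) == (i, j) then 0 else X (k, l) w.
pose C (w : E) := invmx (ridge (zero_row (M0 w) i) t).
pose u (w : E) := (row i (M0 w))^T.
pose a (w : E) := C w j j.
pose b (w : E) := (C w *m u w) j 0.
pose c (w : E) := ((u w)^T *m C w *m u w) 0 0.
pose q x w := 1 + (a w * x ^+ 2 + 2 * b w * x + c w).
pose psi x w := x * ((a w * x + b w) / q x w) -
     v * (a w / q x w - 2 * ((a w * x + b w) / q x w) ^+ 2).
have zM0 w : zero_row (M0 w) i = zero_row (M w) i.
  apply/matrixP => k l; rewrite !mxE; case: eqP => // /eqP ki.
  by rewrite xpair_eqE (negbTE ki).
have rE w : (row i (M w))^T = u w + X (i, j) w *: delta_mx j 0.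
  apply/matrixP => k l; rewrite !mxE xpair_eqE eqxx ord1 eqxx andbT /=.
  by case: eqP => [->|_]; rewrite ?mulr1 ?mulr0 ?add0r ?addr0.
have psiE w : stein_term (M w) (i, j) = psi (X (i, j) w) w.
  rewrite /stein_term /= -zM0 rE -/(C w) [M w i j]mxE.
  by rewrite ridgeV_form_shift// ridgeV_mul_shift.
have mM0 : measurable_mx M0.
  move=> k l; under eq_fun do rewrite mxE.
  case: eqP => [_|/eqP kl]; first exact: measurable_cst.
  by apply: measurable_generators; rewrite !inE.
have mC : measurable_mx C.
  apply: measurable_invmx; apply: measurable_ridge => k l.
  under eq_fun do rewrite mxE.
  by case: eqP => _; [exact: measurable_cst|exact: mM0].
have mU : measurable_mx u by apply: measurable_mx_tr; exact: measurable_mx_row.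
have ma : measurable_fun setT a by exact: mC.
have mb : measurable_fun setT b by apply: measurable_mxM.
have mc : measurable_fun setT c.
  by apply: measurable_mxM => //; apply: measurable_mxM => //; exact: measurable_mx_tr.
have ms : 0 < Num.sqrt v by rewrite sqrtr_gt0.
have s2 : Num.sqrt v ^+ 2 = v by rewrite sqr_sqrtr// ltW.
have stein w : (forall x, `|psi x w| <= K * (1 + x ^+ 2)) /\
    (\int[normal_prob 0 (Num.sqrt v)]_x (psi x w + K * (1 + x ^+ 2))%:E =
     (K * (1 + v))%:E)%E.
  have := @integral_normal_stein_ratio _ _ ms (a w) (b w) (c w) K _ _ _.
  rewrite s2; apply.
  - move=> x; rewrite /a /b /c -ridgeV_form_shift//; exact: ridgeV_form_ge0.
  - exact: ridgeV_diag_ge0.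
  - rewrite /K ler_wpM2r// ?addr_ge0// ?mulr_ge0// ?(ltW v_gt0)//.
    rewrite lerD2l (le_trans (ridgeV_diag_le _ t_gt0 _))//.
    by rewrite ler_pdivlMr// mulrC ridgeV_trace_le.
have pos x w : 0 <= psi x w + K * (1 + x ^+ 2).
  have := (stein w).1 x; rewrite ler_norml => /andP[h _].
  by rewrite -lerBlDr sub0r.
split; first by move=> w; rewrite psiE.
under eq_integral do rewrite psiE.
rewrite (@integral_iid_peel _ _ _ _ _ _ _ lawX (i, j) J
  (fun z => (psi z.1 z.2 + K * (1 + z.1 ^+ 2))%:E)).
- rewrite -[RHS](integral_probability_cst P).
  by apply: eq_integral => w _; exact: (stein w).2.
- by rewrite !inE eqxx.
- have m1 : measurable_fun setT (fst : R * E -> R) by exact: measurable_fst.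
  have m2 (f : E -> R) : measurable_fun setT f ->
    measurable_fun setT (fun z : R * E => f z.2).
    by move=> mf; exact: measurableT_comp mf measurable_snd.
  have mq : measurable_fun setT (fun z : R * E => (q z.1 z.2)^-1).
    apply: measurableT_comp (@measurable_invr R) _.
    apply: measurable_funD => //; apply: measurable_funD; last exact: m2.
    apply: measurable_funD; last first.
      by apply: measurable_funM => //; apply: measurable_funM => //; exact: m2.
    by apply: measurable_funM; [exact: m2|exact: measurable_funX].
  have mf : measurable_fun setT (fun z : R * E => (a z.2 * z.1 + b z.2) / q z.1 z.2).
    apply: measurable_funM => //; apply: measurable_funD; last exact: m2.
    by apply: measurable_funM => //; exact: m2.
  apply/measurable_EFinP/measurable_funD; last first.
    by apply: measurable_funM => //; apply: measurable_funD => //; exact: measurable_funX.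
  apply: measurable_funB; first exact: measurable_funM.
  apply: measurable_funM => //; apply: measurable_funB.
    by apply: measurable_funM => //; exact: m2.
  by apply: measurable_funM => //; exact: measurable_funX.
- by move=> z; rewrite lee_fin.
Qed.

End stein.
End gaussian_matrix.

Section ridge_moment.
Variables (R : realType) (disp : measure_display) (T : measurableType disp).
Variables (P : probability T R) (n d : nat).
Variables (X : 'I_n * 'I_d -> {RV P >-> R}) (v : R).
Hypotheses (v_gt0 : 0 < v) (lawX : iid_centered_normal X v).
Hypothesis lt_dn : (d < n)%N.
Let M (w : T) : 'M[R]_(n, d) := random_matrix X w.

Definition ridge_trace t (w : T) := \tr (invmx (ridge (M w) t)).
Definition ridge_trace2 t (w : T) :=
  \tr (invmx (ridge (M w) t) *m invmx (ridge (M w) t)).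
Definition ridge_moment t w :=
  t * ridge_trace t w + v * ((n%:R - d%:R - 1) * ridge_trace t w +
    t * ridge_trace t w ^+ 2 + t * ridge_trace2 t w).

Lemma measurable_ridgeV t : measurable_mx (fun w => invmx (ridge (M w) t)).
Proof.
by apply: measurable_invmx; apply: measurable_ridge; exact: measurable_random_matrix.
Qed.

Lemma measurable_ridge_trace t : measurable_fun setT (ridge_trace t).
Proof. by apply: measurable_mxtrace; exact: measurable_ridgeV. Qed.

Lemma measurable_ridge_trace2 t : measurable_fun setT (ridge_trace2 t).
Proof.
by apply: measurable_mxtrace; apply: measurable_mxM; exact: measurable_ridgeV.
Qed.

Lemma measurable_ridge_moment t : measurable_fun setT (ridge_moment t).
Proof.
have m1 := measurable_ridge_trace t; have m2 := measurable_ridge_trace2 t.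
apply: measurable_funD; first exact: measurable_funM.
apply: measurable_funM => //; apply: measurable_funD; last exact: measurable_funM.
apply: measurable_funD; first exact: measurable_funM.
by apply: measurable_funM => //; exact: measurable_funX.
Qed.

Let dn_ge0 : 0 <= n%:R - d%:R - 1 :> R.
Proof. by rewrite -addrA -opprD subr_ge0 natr1 ler_nat. Qed.

Lemma ridge_moment_ge t w : 0 < t ->
  v * (n%:R - d%:R - 1) * ridge_trace t w <= ridge_moment t w.
Proof.
move=> t0; have h1 := ridgeV_trace_ge0 (M w) t0; have h2 := ridgeV_sqr_ge0 (M w) t.
rewrite -subr_ge0 (_ : _ - _ = t * ridge_trace t w +
  v * (t * ridge_trace t w ^+ 2 + t * ridge_trace2 t w)); last first.
  by rewrite /ridge_moment; ring.
by rewrite !(addr_ge0, mulr_ge0) ?sqr_ge0 ?(ltW t0) ?(ltW v_gt0).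
Qed.

Lemma ridge_moment_ge0 t w : 0 < t -> 0 <= ridge_moment t w.
Proof.
move=> t0; apply: le_trans (ridge_moment_ge w t0).
by rewrite !mulr_ge0 ?(ltW v_gt0)//; exact: ridgeV_trace_ge0.
Qed.

Lemma integral_ridge_moment t : 0 < t ->
  (\int[P]_w (ridge_moment t w)%:E = d%:R%:E)%E.
Proof.
move=> t_gt0; pose K := (1 + d%:R / t) * (1 + 3 * v).
have K0 : 0 <= K.
  by rewrite /K mulr_ge0// addr_ge0// ?divr_ge0 ?mulr_ge0// ltW.
(* Adding [S] to both sides of [stein_sum] leaves only nonnegative integrands. *)
pose S w := \sum_p K * (1 + X p w ^+ 2).
pose Z w := \sum_p (stein_term v t (M w) p + K * (1 + X p w ^+ 2)).
have E w : d%:R + S w = Z w + ridge_moment t w.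
  rewrite /Z big_split /= -/(S w).
  have -> : \sum_p stein_term v t (M w) p = d%:R - ridge_moment t w.
    have -> : d%:R - ridge_moment t w =
      d%:R - t * \tr (invmx (ridge (M w) t)) -
      v * ((n%:R - d%:R - 1) * \tr (invmx (ridge (M w) t))
      + t * \tr (invmx (ridge (M w) t)) ^+ 2
      + t * \tr (invmx (ridge (M w) t) *m invmx (ridge (M w) t))).
      by rewrite /ridge_moment /ridge_trace /ridge_trace2 opprD addrA.
    by rewrite -stein_sum// pair_bigA.
  by rewrite addrAC subrK addrC.
have mX p : measurable_fun setT (fun w => K * (1 + X p w ^+ 2)).
  by apply: measurable_funM => //; apply: measurable_funD => //; exact: measurable_funX.
have S0 w p : 0 <= K * (1 + X p w ^+ 2) by rewrite mulr_ge0// addr_ge0// sqr_ge0.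
have iS : (\int[P]_w (S w)%:E = (\sum_(p : 'I_n * 'I_d) K * (1 + v))%:E)%E.
  under eq_integral do rewrite -sumEFin.
  rewrite ge0_integral_sum//; [|by move=> p; exact/measurable_EFinP|
    by move=> p w _; rewrite lee_fin].
  rewrite -sumEFin; apply: eq_bigr => p _.
  under eq_integral do rewrite EFinM.
  rewrite ge0_integralZl_EFin//; last 2 first.
  - by move=> w _; rewrite lee_fin addr_ge0// sqr_ge0.
  - by apply/measurable_EFinP/measurable_funD => //; exact: measurable_funX.
  under eq_integral do rewrite EFinD.
  rewrite ge0_integralD//; last 2 first.
  - by move=> w _; rewrite lee_fin sqr_ge0.
  - by apply/measurable_EFinP; exact: measurable_funX.
  rewrite integral_probability_cst (EFinM K) (EFinD 1); congr (_ * (_ + _))%E.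
  (* The second moment of one entry is the affine formula with indicator coefficients. *)
  transitivity (\int[P]_w ((0 + \sum_k (k == p)%:R * X k w) ^+ 2)%:E)%E.
    apply: eq_integral => w _; rewrite add0r (bigD1 p)//= eqxx mul1r big1 ?addr0//.
    by move=> k /negbTE ->; rewrite mul0r.
  rewrite (integral_iid_affine_sqr v_gt0 lawX) expr0n add0r (bigD1 p)//= eqxx expr1n.
  rewrite big1 ?addr0 ?mulr1// => k /negbTE ->.
  by rewrite expr0n.
have st p := stein_term_expectation v_gt0 lawX t_gt0 p.
have iZ : (\int[P]_w (Z w)%:E = (\sum_(p : 'I_n * 'I_d) K * (1 + v))%:E)%E.
  under eq_integral do rewrite -sumEFin.
  rewrite ge0_integral_sum//.
  - by rewrite -sumEFin; apply: eq_bigr => p _; exact: (st p).2.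
  - move=> p; apply/measurable_EFinP/measurable_funD => //.
    exact: measurable_stein_term.
  - by move=> p w _; rewrite lee_fin; exact: (st p).1.
have mm := measurable_ridge_moment t.
have : (\int[P]_w (d%:R + S w)%:E = \int[P]_w (Z w + ridge_moment t w)%:E)%E.
  by apply: eq_integral => w _; rewrite E.
under eq_integral do rewrite EFinD.
under [in RHS]eq_integral do rewrite EFinD.
have mZ : measurable_fun setT Z.
  apply: measurable_sum => p; apply: measurable_funD => //.
  exact: measurable_stein_term.
have mS : measurable_fun setT S by exact: measurable_sum.
have Z0 w : 0 <= Z w by apply: sumr_ge0 => p _; exact: (st p).1.
have {}S0 w : 0 <= S w by apply: sumr_ge0.
have m0 w := ridge_moment_ge0 w t_gt0.
rewrite ge0_integralD//=; [|by move=> w _; rewrite lee_fin|exact/measurable_EFinP].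
rewrite ge0_integralD//=; [|by move=> w _; rewrite lee_fin|exact/measurable_EFinP|
  by move=> w _; rewrite lee_fin|exact/measurable_EFinP].
rewrite integral_probability_cst iS iZ addeC.
(* The other integrals are finite, which excludes an infinite value here and allows cancellation. *)
by case: (integral _ _ _) => [r|//|//] -[/addrI ->].
Qed.

End ridge_moment.

(** * Removing the ridge parameter *)

Section inverse_wishart.
Variables (R : realType) (disp : measure_display) (T : measurableType disp).
Variables (P : probability T R) (n d : nat).
Variables (X : 'I_n * 'I_d -> {RV P >-> R}) (v : R).
Hypotheses (v_gt0 : 0 < v) (lawX : iid_centered_normal X v).
Hypothesis lt_dn : (d.+1 < n)%N.
Let M (w : T) : 'M[R]_(n, d) := random_matrix X w.
Let G (w : T) : 'M[R]_d := (M w)^T *m M w.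
Let tau0 (w : T) : R := \tr (invmx (G w)).
Let t_ (k : nat) : R := k.+1%:R^-1.
Let t_gt0 k : 0 < t_ k. Proof. by rewrite invr_gt0. Qed.
Let tau k w := ridge_trace X (t_ k) w.
Let c : R := v * (n%:R - d%:R - 1).

Let c_gt0 : 0 < c.
Proof. by rewrite mulr_gt0// -addrA -opprD subr_gt0 natr1 ltr_nat. Qed.

Let measurable_G : measurable_mx G.
Proof.
apply: measurable_mxM; last exact: measurable_random_matrix.
by apply: measurable_mx_tr; exact: measurable_random_matrix.
Qed.

Let measurable_tau0 : measurable_fun setT tau0.
Proof. by apply: measurable_mxtrace; exact: measurable_invmx. Qed.

Let tau_ge0 k w : 0 <= tau k w. Proof. exact: ridgeV_trace_ge0. Qed.

Let tau_cvg w : G w \in unitmx -> tau k w @[k --> \oo] --> tau0 w.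
Proof.
move=> uG.
pose b := (\sum_i \sum_j `|invmx (G w) i j|) * tau0 w.
apply: (@squeeze_cvgr _ _ _ _ (fun k => tau0 w - k.+1%:R^-1 * b) (cst (tau0 w))).
- apply: nearW => k; rewrite ridgeV_trace_le_gramV// andbT.
  by rewrite lerBlDr addrC -lerBlDr /b mulrA gramV_trace_sub_le.
- rewrite -[X in _ --> X](subr0 (tau0 w)) -(mul0r b).
  apply: cvgB; first exact: cvg_cst.
  by apply: cvgM; [exact: cvg_harmonic|exact: cvg_cst].
- exact: cvg_cst.
Qed.

Let tau_dvg w : G w \notin unitmx -> (tau k w)%:E @[k --> \oo] --> +oo%E.
Proof.
move=> sG; have [e e0 eP] := ridgeV_trace_singular sG.
apply/cvgeryP/cvgryPge => A; near=> k.
apply: le_trans (eP _ (t_gt0 k)).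
rewrite /t_ invrK mulrC -ler_pdivrMr//.
apply: (@le_trans _ _ k%:R); last by rewrite ler_nat.
by near: k; exact: nbhs_infty_ger.
Unshelve. all: by end_near. Qed.

(** The pointwise limit of [tau k]. The value +oo on singular matrices turns integrability into
    almost sure invertibility, whereas [tau0] is finite there by the convention for [invmx]. *)
Let tau_lim w : \bar R := if G w \in unitmx then (tau0 w)%:E else +oo%E.

Let integral_tau_le k : (\int[P]_w (tau k w)%:E <= (d%:R / c)%:E)%E.
Proof.
have h : (c%:E * \int[P]_w (tau k w)%:E <= d%:R%:E)%E.
  rewrite -(integral_ridge_moment v_gt0 lawX (ltnW lt_dn) (t_gt0 k)).
  rewrite -ge0_integralZl_EFin//; last 3 first.
  - by move=> w _; rewrite lee_fin.
  - by apply/measurable_EFinP; exact: measurable_ridge_trace.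
  - exact: ltW.
  apply: ge0_le_integral => //.
  - by move=> w _; rewrite -EFinM lee_fin mulr_ge0// ltW.
  - by apply/measurable_EFinP/measurable_funM => //; exact: measurable_ridge_trace.
  - by apply/measurable_EFinP; exact: measurable_ridge_moment.
  - move=> w _; rewrite -EFinM lee_fin.
    by apply: ridge_moment_ge => //; exact: ltnW.
by rewrite EFinM muleC lee_pdivlMl.
Qed.

Let integral_tau_lim_le : (\int[P]_w tau_lim w <= (d%:R / c)%:E)%E.
Proof.
have -> : (\int[P]_w tau_lim w = \int[P]_w limn_einf (fun k => (tau k w)%:E))%E.
  apply: eq_integral => w _; rewrite /tau_lim; case: ifPn => [uG|sG].
    have /cvg_limn_einf_sup [-> //] : (tau k w)%:E @[k --> \oo] --> (tau0 w)%:E.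
    by apply: cvg_EFin; [exact: nearW|exact: tau_cvg].
  by have [-> _] := cvg_limn_einf_sup (tau_dvg sG).
apply: (le_trans (fatou P measurableT _ _)).
- by move=> k; apply/measurable_EFinP; exact: measurable_ridge_trace.
- by move=> k w _; rewrite lee_fin.
rewrite limn_einf_lim; apply: lime_le; first exact: is_cvg_einfs.
apply: nearW => k; apply: le_trans (integral_tau_le k).
by apply: ereal_inf_lbound; exists k => /=.
Qed.

Let measurable_tau_lim : measurable_fun setT tau_lim.
Proof.
apply: measurable_fun_ifT => //; first exact: measurable_unitmx.
exact/measurable_EFinP.
Qed.

Let tau_lim_ge0 w : (0 <= tau_lim w)%E.
Proof.
rewrite /tau_lim; case: ifPn => // uG.
by rewrite lee_fin; exact: gramV_trace_ge0.
Qed.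

Let integrable_tau_lim : P.-integrable setT tau_lim.
Proof.
apply/integrableP; split=> //.
under eq_integral do rewrite gee0_abs//.
by apply: le_lt_trans integral_tau_lim_le _; rewrite ltry.
Qed.

Lemma gram_unit_ae : {ae P, forall w, (random_matrix X w)^T *m random_matrix X w \in unitmx}.
Proof.
have := integrable_ae measurableT integrable_tau_lim.
apply: filterS => w /(_ I); rewrite /tau_lim.
by case: ifP.
Qed.

Lemma integral_gramV_trace :
  (\int[P]_w (\tr (invmx ((random_matrix X w)^T *m random_matrix X w)))%:E =
   (d%:R / (v * (n%:R - d%:R - 1)))%:E)%E.
Proof.
pose H k w := ridge_moment X v (t_ k) w.
have HE k : (\int[P]_w (H k w)%:E = d%:R%:E)%E.
  exact: (integral_ridge_moment v_gt0 lawX (ltnW lt_dn) (t_gt0 k)).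
have [ic _ H_cvg] : [/\ P.-integrable setT (fun w => (c * tau0 w)%:E),
    (\int[P]_w `|(H k w)%:E - (c * tau0 w)%:E|)%E @[k --> \oo] --> 0%E &
    (\int[P]_w (H k w)%:E)%E @[k --> \oo] --> (\int[P]_w (c * tau0 w)%:E)%E].
  (* One summand for each term of [ridge_moment]: the bounds are t <= 1, tr B <= tr(G^-1), t tr B <=
     d and t tr(B^2) <= tr B. *)
  pose L : R := 1 + c + v * d%:R + v.
  apply: (@dominated_convergence _ _ _ P setT measurableT
    (fun k w => (H k w)%:E) (fun w => (c * tau0 w)%:E)
    (fun w => L%:E * tau_lim w)%E).
  - by move=> k; apply/measurable_EFinP; exact: measurable_ridge_moment.
  - by apply/measurable_EFinP; exact: measurable_funM.
  - apply: filterS gram_unit_ae => w uG _.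
    apply: cvg_EFin; first exact: nearW.
    have t_cvg : t_ k @[k --> \oo] --> 0 := @cvg_harmonic R.
    have tw := tau_cvg uG.
    have t2 : t_ k * ridge_trace2 X (t_ k) w @[k --> \oo] --> 0.
      (* Each entry of B is at most tr B <= [tau0 w], so [b] bounds tr(B^2) independently of k and
         the factor t sends the term to 0. *)
      pose b := \sum_(i < d) \sum_(j < d) tau0 w ^+ 2.
      apply: (@squeeze_cvgr _ _ _ _ (cst 0) (fun k => t_ k * b)).
      - apply: nearW => k; rewrite mulr_ge0 ?(ltW (t_gt0 k)) ?ridgeV_sqr_ge0//=.
        rewrite ler_wpM2l ?(ltW (t_gt0 k))// /ridge_trace2 ridgeV_sqr//.
        apply: ler_sum => i _; apply: ler_sum => j _.
        rewrite -(real_normK (num_real (invmx _ i j))) lerXn2r ?nnegrE//.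
          exact: gramV_trace_ge0.
        apply: le_trans (ridgeV_entry_le _ _ _ _) _ => //.
        exact: ridgeV_trace_le_gramV.
      - exact: cvg_cst.
      - by rewrite -(mul0r b); apply: cvgM => //; exact: cvg_cst.
    rewrite (_ : c * tau0 w = 0 * tau0 w + v * ((n%:R - d%:R - 1) * tau0 w +
      0 * (tau0 w * tau0 w) + 0)); last by rewrite /c; ring.
    apply: cvgD; first exact: cvgM.
    apply: cvgM; first exact: cvg_cst.
    apply: cvgD => //; apply: cvgD; first by apply: cvgM => //; exact: cvg_cst.
    by apply: cvgM => //; apply: cvgM.
  - exact: integrableZl.
  - apply: filterS gram_unit_ae => w uG k _.
    rewrite /tau_lim uG -EFinM abse_EFin lee_fin.
    rewrite ger0_norm ?ridge_moment_ge0//; last exact: ltnW.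
    have t1 : t_ k <= 1 by rewrite invf_le1// ler1n.
    have tk := t_gt0 k; have h0 := tau_ge0 k w.
    have h1 : tau k w <= tau0 w by exact: ridgeV_trace_le_gramV.
    have h2 : t_ k * tau k w <= d%:R by exact: ridgeV_trace_le.
    have h3 : t_ k * ridge_trace2 X (t_ k) w <= tau k w by exact: ridgeV_sqr_le.
    have -> : H k w = t_ k * tau k w + c * tau k w + v * (t_ k * tau k w * tau k w) +
        v * (t_ k * ridge_trace2 X (t_ k) w).
      by rewrite /H /ridge_moment -/(tau k w) /c; ring.
    have -> : L * tau0 w = tau0 w + c * tau0 w + v * (d%:R * tau0 w) + v * tau0 w.
      by rewrite /L; ring.
    rewrite !lerD//.
    - by apply: le_trans h1; rewrite ler_piMl.
    - by rewrite ler_wpM2l// ltW.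
    - rewrite ler_wpM2l ?(ltW v_gt0)// ler_pM// mulr_ge0//; exact: ltW.
    - by rewrite ler_wpM2l ?(ltW v_gt0)// (le_trans h3).
have intE : (\int[P]_w (c * tau0 w)%:E = d%:R%:E)%E.
  apply: cvg_unique H_cvg _ => //.
  rewrite (_ : (fun k => _) = cst (d%:R%:E)); last exact/funext.
  exact: cvg_cst.
rewrite -/c mulrC EFinM -intE -integralZl//.
apply: eq_integral => w _.
by rewrite -EFinM mulKf// gt_eqF.
Qed.

End inverse_wishart.

(** * The average test error *)

Section sigma_generated.
Variables (R : realType) (disp : measure_display) (T : measurableType disp).
Variables (P : probability T R) (I : finType) (X : I -> {RV P >-> R}).

(** The generating family inside [sigma_generated], named so that it can serve as a measurable
    structure on [T]. *)
Definition preimages : set (set T) :=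
  [set B | exists (i : I) (A : set R), measurable A /\ B = X i @^-1` A].

Lemma preimages_measurable : <<s preimages >> `<=` measurable.
Proof.
apply: smallest_sub; first exact: sigma_algebra_measurable.
move=> _ [i [A [mA ->]]]; exact: measurable_funPTI.
Qed.

Lemma measurable_preimages i :
  measurable_fun setT (X i : g_sigma_algebraType preimages -> R).
Proof.
move=> _ A mA; rewrite setTI; apply: sub_gen_smallest.
by exists i, A.
Qed.

End sigma_generated.

Section finite_sample.
Variables (R : realType) (n d : nat).

Lemma MSE_iid_normal (disp : measure_display) (S : measurableType disp)
    (Q : probability S R) (x : 'I_d -> {RV Q >-> R}) (v : R)
    (b c : 'cV[R]_d) : 0 < v -> iid_centered_normal x v ->
  MSE x b c = (v * \sum_l (b l 0 - c l 0) ^+ 2)%:E.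
Proof.
move=> v0 lawx; rewrite /MSE unlock.
transitivity (\int[Q]_s ((0 + \sum_l (b l 0 - c l 0) * x l s) ^+ 2)%:E)%E.
  apply: eq_integral => s _; congr (_ ^+ 2)%:E.
  rewrite add0r /dot -sumrB; apply: eq_bigr => l _.
  by rewrite !mxE; ring.
by rewrite (integral_iid_affine_sqr v0 lawx) expr0n add0r.
Qed.

Section training.
Variables (disp : measure_display) (T : measurableType disp).
Variables (P : probability T R).
Variables (X : 'I_n * 'I_d -> {RV P >-> R}) (eps : 'I_n -> {RV P >-> R}).
Hypothesis lt_dn : (d.+1 < n)%N.
Hypothesis lawX : iid_centered_normal X n%:R^-1.
Hypothesis law_eps : iid_centered_normal eps 1.
Hypothesis indep : independent_families X eps.
Variables (sigma alpha : R) (beta0 : 'cV[R]_d).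
Hypothesis alpha_ge0 : 0 <= alpha.

Let M (w : T) := random_matrix X w.
Let pinv (w : T) : 'M[R]_(d, n) := invmx ((M w)^T *m M w) *m (M w)^T.
Let k1 := alpha / (1 + alpha).
Let k2 := sigma / (1 + alpha).

Let alpha1_neq0 : 1 + alpha != 0.
Proof. by rewrite gt_eqF// ltr_pwDl. Qed.

(** The sample point is split in two: [e] drives the noise and [w] the design. Independence can then
    average over [e] with [w] frozen. *)
Let residual (e w : T) (l : 'I_d) : R :=
  k1 * beta0 l 0 + \sum_i (- k2 * pinv w l i) * eps i e.

Lemma spectral_residual w l : (M w)^T *m M w \in unitmx ->
  beta0 l 0 - spectral_estimator alpha (M w)
    (M w *m beta0 + sigma *: random_vector eps w) l 0 = residual w w l.
Proof.
move=> uG; rewrite /spectral_estimator -/(pinv w) mulmxDr.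
have -> : pinv w *m (M w *m beta0) = beta0.
  by rewrite /pinv mulmxA -(mulmxA (invmx _)) mulVmx// mul1mx.
rewrite -scalemxAr /residual mxE mxE [X in _ - _ * (_ + X)]mxE.
have -> : \sum_i (- k2 * pinv w l i) * eps i w =
    - k2 * (pinv w *m random_vector eps w) l 0.
  rewrite mxE mulr_sumr; apply: eq_bigr => i _; rewrite -mulrA.
  by congr (_ * (_ * _)); rewrite mxE.
by rewrite /k1 /k2; field.
Qed.

Let noise_integral w :
  (\int[P]_e (\sum_l residual e w l ^+ 2)%:E =
   (k1 ^+ 2 * dot beta0 beta0 + k2 ^+ 2 * \sum_l \sum_i pinv w l i ^+ 2)%:E)%E.
Proof.
under eq_integral do rewrite -sumEFin.
rewrite ge0_integral_sum//; first last.
- by move=> l e _; rewrite lee_fin sqr_ge0.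
- move=> l; apply/measurable_EFinP/measurable_funX/measurable_funD => //.
  by apply: measurable_sum => i; exact: measurable_funM.
under eq_bigr => l _ do rewrite (integral_iid_affine_sqr ltr01 law_eps).
rewrite sumEFin; congr EFin.
rewrite big_split /= /dot !mulr_sumr; congr (_ + _); apply: eq_bigr => l _.
  by rewrite expr2; ring.
rewrite mul1r mulr_sumr; apply: eq_bigr => i _; ring.
Qed.

(** The squared Frobenius norm of G^-1 X^T is tr(G^-1 X^T X G^-1), and the middle G cancels one
    inverse. *)
Lemma pinv_frobenius w : (M w)^T *m M w \in unitmx ->
  \sum_l \sum_i pinv w l i ^+ 2 = \tr (invmx ((M w)^T *m M w)).
Proof.
move=> uG; rewrite gramV_trE// mxtrace_trmx_mul exchange_big /=.
have pE : pinv w = (M w *m invmx ((M w)^T *m M w))^T.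
  by rewrite trmx_mul trmx_inv trmx_mul trmxK.
apply: eq_bigr => l _; apply: eq_bigr => i _.
by rewrite pE [X in X ^+ 2]mxE expr2.
Qed.

(** The formula is exact at every size with d + 1 < n. Entry variance 1/n makes E tr(G^-1) equal to
    nd/(n-d-1), and the outer division by n is the variance of the coordinates of [x]. *)
Lemma average_test_error_finite (dispS : measure_display)
    (S : measurableType dispS) (Q : probability S R) (x : 'I_d -> {RV Q >-> R}) :
  iid_centered_normal x n%:R^-1 ->
  average_test_error sigma alpha beta0 X eps x =
  (((alpha / (1 + alpha)) ^+ 2 * dot beta0 beta0 + (sigma / (1 + alpha)) ^+ 2 *
    (n%:R * d%:R / (n%:R - d%:R - 1))) / n%:R)%:E.
Proof.
move=> lawx.
have n_gt0 : 0 < n%:R :> R by rewrite ltr0n (leq_trans _ lt_dn).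
have v_gt0 : 0 < n%:R^-1 :> R by rewrite invr_gt0.
have uG := gram_unit_ae v_gt0 lawX lt_dn.
have mM := measurable_random_matrix X.
have mG : measurable_mx (fun w => invmx ((M w)^T *m M w)).
  by apply: measurable_invmx; apply: measurable_mxM => //; exact: measurable_mx_tr.
have mpinv : measurable_mx pinv.
  by apply: measurable_mxM => //; exact: measurable_mx_tr.
have meps : measurable_mx (random_vector eps).
  by move=> i j; under eq_fun do rewrite mxE; exact: measurable_funPT.
have mres : measurable_fun setT (fun w => \sum_l residual w w l ^+ 2).
  apply: measurable_sum => l; apply: measurable_funX; apply: measurable_funD => //.
  apply: measurable_sum => i; apply: measurable_funM => //.
  exact: measurable_funM.
rewrite /average_test_error /=.
under eq_integral do rewrite (MSE_iid_normal _ _ v_gt0 lawx).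
(* The residual formula requires an invertible Gram matrix, so the integrands are identified only
   almost everywhere. *)
transitivity (\int[P]_w (n%:R^-1%:E * (\sum_l residual w w l ^+ 2)%:E))%E.
  apply: ae_eq_integral => //.
  - apply/measurable_EFinP/measurable_funM => //; apply: measurable_sum => l.
    apply: measurable_funX; apply: measurable_funB => //.
    have : measurable_mx (fun w => spectral_estimator alpha (M w)
        (M w *m beta0 + sigma *: random_vector eps w)).
      apply: measurable_mxZ; apply: measurable_mxM => //.
      apply: measurable_mxD; last exact: measurable_mxZ.
      apply: measurable_mxM => //; exact: measurable_mx_cst.
    by apply.
  - by apply/measurable_funeM/measurable_EFinP.
  - apply: filterS uG => w uGw _; rewrite -EFinM; congr (_ * _)%:E.
    by apply: eq_bigr => l _; rewrite spectral_residual.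
have res_ge0 e w : (0 <= (\sum_l residual e w l ^+ 2)%:E)%E.
  by rewrite lee_fin sumr_ge0// => l _; exact: sqr_ge0.
rewrite ge0_integralZl_EFin//; last exact/measurable_EFinP.
rewrite (@integral_subsigmas_independent _ _ _ P (preimages eps) (preimages X)
  (fun z => (\sum_l residual z.1 z.2 l ^+ 2)%:E)); last first.
- by move=> z.
- apply/measurable_EFinP; apply: measurable_sum => l; apply: measurable_funX.
  apply: measurable_funD => //; apply: measurable_sum => i.
  apply: measurable_funM; last first.
    apply: measurableT_comp measurable_fst; exact: measurable_preimages.
  apply: measurable_funM => //.
  have mM' : measurable_mx (M : g_sigma_algebraType (preimages X) -> _).
    by move=> a b; under eq_fun do rewrite mxE; exact: measurable_preimages.
  have mp : measurable_mx (pinv : g_sigma_algebraType (preimages X) -> _).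
    apply: measurable_mxM; last exact: measurable_mx_tr.
    by apply: measurable_invmx; apply: measurable_mxM => //; exact: measurable_mx_tr.
  exact: measurableT_comp (mp l i) measurable_snd.
- by move=> A B sA sB; rewrite setIC muleC; exact: indep.
- exact: preimages_measurable.
- exact: preimages_measurable.
have mp2 : measurable_fun setT (fun w => \sum_l \sum_i pinv w l i ^+ 2).
  by do 2! apply: measurable_sum => ?; exact: measurable_funX.
under eq_integral do rewrite noise_integral EFinD.
have k0 : 0 <= k1 ^+ 2 * dot beta0 beta0.
  by rewrite mulr_ge0 ?sqr_ge0// sumr_ge0// => l _; rewrite -expr2 sqr_ge0.
have p0 w : 0 <= \sum_l \sum_i pinv w l i ^+ 2.
  by do 2! apply: sumr_ge0 => ? _; rewrite sqr_ge0.
rewrite ge0_integralD//=; [|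
  by move=> w _; rewrite lee_fin mulr_ge0 ?sqr_ge0|
  by apply/measurable_EFinP/measurable_funM].
rewrite integral_probability_cst.
under eq_integral do rewrite EFinM.
rewrite ge0_integralZl_EFin//; [|by move=> w _; rewrite lee_fin|
  exact/measurable_EFinP|exact: sqr_ge0].
have -> : (\int[P]_w (\sum_l \sum_i pinv w l i ^+ 2)%:E =
    \int[P]_w (\tr (invmx ((M w)^T *m M w)))%:E)%E.
  apply: ae_eq_integral => //; first exact/measurable_EFinP.
    exact/measurable_EFinP/measurable_mxtrace.
  by apply: filterS uG => w uGw _; rewrite pinv_frobenius.
rewrite (integral_gramV_trace v_gt0 lawX lt_dn) -EFinM.
congr EFin; rewrite /k1 /k2 mulrC; congr ((_ + _ * _) * _).
have dn : n%:R - d%:R - 1 != 0 :> R.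
  by rewrite -addrA -opprD gt_eqF// subr_gt0 natr1 ltr_nat.
by field; rewrite dn gt_eqF.
Qed.

End training.
End finite_sample.

(** * The proportional limit *)

Theorem proposition2p2 (R : realType) (lambda beta sigma alpha : R)
    (lambda_gt0 : 0 < lambda) (lambda_lt1 : lambda < 1) (beta_gt0 : 0 < beta)
    (sigma_ge0 : 0 <= sigma) (alpha_ge0 : 0 <= alpha)
    (N d : nat -> nat)
    (beta0 : forall k : nat, 'cV[R]_(d k))
    (dispT : nat -> measure_display)
    (T : forall k : nat, measurableType (dispT k))
    (P : forall k : nat, probability (T k) R)
    (X : forall k : nat, 'I_(N k) * 'I_(d k) -> {RV (P k) >-> R})
    (eps : forall k : nat, 'I_(N k) -> {RV (P k) >-> R})
    (dispS : nat -> measure_display)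
    (S : forall k : nat, measurableType (dispS k))
    (Q : forall k : nat, probability (S k) R)
    (x : forall k : nat, 'I_(d k) -> {RV (Q k) >-> R})
    (X_law : forall k : nat, iid_centered_normal (X k) (N k)%:R^-1)
    (eps_law : forall k : nat, iid_centered_normal (eps k) 1)
    (X_eps_indep : forall k : nat, independent_families (X k) (eps k))
    (x_law : forall k : nat, iid_centered_normal (x k) (N k)%:R^-1)
    (N_infty : N k @[k --> \oo] --> \oo)
    (d_infty : d k @[k --> \oo] --> \oo)
    (ratio_cvg : ((d k)%:R / (N k)%:R : R) @[k --> \oo] --> lambda)
    (beta0_cvg : dot (beta0 k) (beta0 k) / (d k)%:R @[k --> \oo]
                   --> beta ^+ 2) :
  average_test_error sigma alpha (beta0 k) (X k) (eps k) (x k) @[k --> \oo]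
    --> (Err_infty lambda beta sigma alpha)%:E.
Proof.
have a_neq0 : 1 + alpha != 0 by rewrite gt_eqF// ltr_pwDl.
have l_neq0 : 1 - lambda != 0 by rewrite subr_eq0 gt_eqF.
pose r k : R := (d k)%:R / (N k)%:R.
have Ninv : (N k)%:R^-1 @[k --> \oo] --> (0 : R).
  apply: (cvg_comp N _ N_infty (_ : (fun n => n%:R^-1) @ \oo --> (0 : R))).
  by rewrite -(cvg_shiftS (fun n => n%:R^-1 : R)); exact: cvg_harmonic.
have den_cvg : 1 - r k - (N k)%:R^-1 @[k --> \oo] --> 1 - lambda.
  rewrite -[X in _ --> X]subr0; apply: cvgB => //.
  by apply: cvgB => //; exact: cvg_cst.
(* The finite-sample error in terms of the convergent quantities |beta0|^2/d, r = d/N and 1/N, using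
   N-d-1 = N(1 - r - 1/N). *)
pose g k : R := (alpha / (1 + alpha)) ^+ 2 *
    (dot (beta0 k) (beta0 k) / (d k)%:R * r k) +
  (sigma / (1 + alpha)) ^+ 2 * (r k / (1 - r k - (N k)%:R^-1)).
have g_cvg : g k @[k --> \oo] --> Err_infty lambda beta sigma alpha.
  have -> : Err_infty lambda beta sigma alpha =
      (alpha / (1 + alpha)) ^+ 2 * (beta ^+ 2 * lambda) +
      (sigma / (1 + alpha)) ^+ 2 * (lambda / (1 - lambda)).
    by rewrite /Err_infty; field; rewrite a_neq0 l_neq0.
  apply: cvgD; (apply: cvgM; first exact: cvg_cst); first exact: cvgM.
  by apply: cvgM => //; exact: cvgV.
have : (g k)%:E @[k --> \oo] --> (Err_infty lambda beta sigma alpha)%:E.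
  by apply: cvg_EFin => //; exact: nearW.
apply: cvg_trans.
apply: near_eq_cvg; near=> k.
have N_gt0 : (0 < N k)%N by near: k; exact: (N_infty _ (nbhs_infty_gt 0)).
have d_gt0 : (0 < d k)%N by near: k; exact: (d_infty _ (nbhs_infty_gt 0)).
have NR : (N k)%:R != 0 :> R by rewrite pnatr_eq0 -lt0n.
have dR : (d k)%:R != 0 :> R by rewrite pnatr_eq0 -lt0n.
(* The limit 1 - lambda is positive, so d + 1 < N eventually, which is the range of the
   finite-sample formula. *)
have den_gt0 : 0 < 1 - r k - (N k)%:R^-1.
  by near: k; apply: (cvgr_gt _ den_cvg); rewrite subr_gt0.
have E : (N k)%:R - (d k)%:R - 1 = (N k)%:R * (1 - r k - (N k)%:R^-1) :> R.
  by rewrite /r; field.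
have lt_dN : ((d k).+1 < N k)%N.
  rewrite -(ltr_nat R) -natr1 -subr_gt0 opprD addrA E.
  by rewrite mulr_gt0// ltr0n.
rewrite /= (average_test_error_finite lt_dN (X_law k) (eps_law k) (X_eps_indep k)
  sigma (beta0 k) alpha_ge0 (x_law k)).
congr EFin; rewrite E /g.
move: (1 - r k - (N k)%:R^-1) (lt0r_neq0 den_gt0) => D D_neq0.
rewrite /r; field; rewrite ?NR ?dR ?D_neq0 ?a_neq0 //.
Unshelve. all: by end_near. Qed.
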